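(* Let $b:\mathbb{R}^d\times\mathcal{P}(\mathbb{R}^d)\to\mathbb{R}^d$, $\sigma:\mathbb{R}^d\times\mathcal{P}(\mathbb{R}^d)\to\mathbb{R}^{d\times m_1}$, $\overline\sigma:\mathbb{R}^d\times\mathcal{P}(\mathbb{R}^d)\to\mathbb{R}^{d\times m_2}$ and $\sigma_0,\sigma_1\in\mathbb{R}$. Suppose: (i) $b(\cdot,\delta_0)$ is locally Lipschitz continuous and there are constants $\lambda_1>0$, $l_0\ge 1$ and an increasing continuous function $\phi:[0,\infty)\to[0,\infty)$ with $\phi(0)=0$ such that for all $x,y\in\mathbb{R}^d$, $\mu\in\mathcal{P}_1(\mathbb{R}^d)$, $$\langle x-y,b(x,\mu)-b(y,\mu)\rangle\le |x-y|\phi(|x-y|)\mathbf{1}_{\{|x-y|\le l_0\}}-\lambda_1|x-y|^2\mathbf{1}_{\{|x-y|>l_0\}};$$ moreover there is $\lambda_2>0$ such that $|b(x,\mu)-b(x,\nu)|\le\lambda_2\mathbb{W}_1(\mu,\nu)$ for all $x\in\mathbb{R}^d$, $\mu,\nu\in\mathcal{P}_1(\mathbb{R}^d)$; (ii) there are $l\ge0$, $K>0$ such that $|b(x,\mu)-b(y,\mu)|\le K(1+|x|^l+|y|^l)|x-y|$ for all $x,y\in\mathbb{R}^d$, $\mu\in\mathcal{P}_1(\mathbb{R}^d)$; (iii) there is $\hat L>0$ such that $|\sigma(x,\mu)|\vee|\overline\sigma(x,\mu)|\le\hat L$ for all $x\in\mathbb{R}^d$, $\mu\in\mathcal{P}_1(\mathbb{R}^d)$;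 (iv) there are $\overline\lambda_1,\overline\lambda_2,\overline\lambda_3>0$ with $\overline\lambda_1>2\overline\lambda_2$ such that $\langle x,b(x,\mu)\rangle\le-\overline\lambda_1|x|^{l+2}+\overline\lambda_2\mathbb{W}_1^2(\mu,\delta_0)+\overline\lambda_3$ for all $x\in\mathbb{R}^d$, $\mu\in\mathcal{P}_1(\mathbb{R}^d)$. Let $\alpha\in(0,1]$, $\hat K=2K+\lambda_2+|b(0,\delta_0)|$ and $$h^*=1\wedge\frac1{\overline\lambda_1}\wedge\frac{4\alpha^2(\overline\lambda_1-2\overline\lambda_2)^2}{9\hat K^4(1+2\alpha)^2}.$$ Then for any $p\ge1$ and $h\in(0,h^*]$ there is a constant $C>0$ such that the tamed Euler–Maruyama scheme $(\overline X_{nh}^{i,N,h})$ defined in the context satisfies, for all $n\in\mathbb{N}$ and $i\in\mathbb{S}_N$, $$\mathbb{E}|\overline X_{nh}^{i,N,h}|^p\le C\big(1+\mathbb{E}|\overline X_0^{i,N,h}|^p\big)$$ in case $\mathbb{E}|\overline X_0^{i,N,h}|^p<\infty$.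
   Context: Notation. $|\cdot|$ is the Euclidean norm of vectors and the Hilbert–Schmidt norm of matrices; $a\vee b=\max\{a,b\}$, $a\wedge b=\min\{a,b\}$; $\delta_x$ is the Dirac mass at $x$; $\mathbb{S}_N=\{1,\dots,N\}$. $\mathcal{P}(\mathbb{R}^d)$ is the set of Borel probability measures on $\mathbb{R}^d$, $\mathcal{P}_1(\mathbb{R}^d)$ those with finite first moment, and $\mathbb{W}_1(\mu,\nu)=\inf_{\pi}\int|x-y|\,\pi(\mathrm{d}x,\mathrm{d}y)$, the infimum over couplings $\pi$ of $\mu$ and $\nu$. Probability spaces. $(\Omega^B,\mathcal{F}^B,(\mathcal{F}^B_t)_{t\ge0},\mathbb{P}^B)$ and $(\Omega^W,\mathcal{F}^W,(\mathcal{F}^W_t)_{t\ge0},\mathbb{P}^W)$ are complete filtered probability spaces satisfying the usual conditions; $\Omega=\Omega^B\times\Omega^W$, $\mathbb{P}=\mathbb{P}^B\times\mathbb{P}^W$, with expectation $\mathbb{E}$. On $\Omega^B$ there are Brownian motions $B^i$ (dimension $d$) and $\overline B^i$ (dimension $m_1$), $i\in\mathbb{S}_N$; on $\Omega^W$ there are Brownian motions $W$ (dimension $d$) and $\overline W$ (dimension $m_2$); all are mutually independent. Tamed Euler–Maruyama scheme with step size $h>0$: for $n\ge0$, $i\in\mathbb{S}_N$, $$\overline X_{(n+1)h}^{i,N,h}=\overline X_{nh}^{i,N,h}+\frac{b(\overline X_{nh}^{i,N,h},\widetilde\mu_{nh}^{\overline X,N,h})}{1+\alpha\sqrt h\,|\overline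 X_{nh}^{i,N,h}|^l}h+\sigma_0\Delta B_n^i+\sigma(\overline X_{nh}^{i,N,h},\widetilde\mu_{nh}^{\overline X,N,h})\Delta\overline B_n^i+\sigma_1\Delta W_n+\overline\sigma(\overline X_{nh}^{i,N,h},\widetilde\mu_{nh}^{\overline X,N,h})\Delta\overline W_n,$$ where $\Delta B_n^i=B^i_{(n+1)h}-B^i_{nh}$ and similarly for $\Delta\overline B_n^i,\Delta W_n,\Delta\overline W_n$, and $\widetilde\mu_{nh}^{\overline X,N,h}=\frac1N\sum_{j=1}^N\delta_{\overline X_{nh}^{j,N,h}}$. The initial data $(\overline X_0^{i,N,h})_{i\in\mathbb{S}_N}$ are i.i.d. and $\mathcal{F}_0^B$-measurable. *)

(* Defs.v *)
From HB Require Import structures.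
From mathcomp Require Import all_boot all_order all_algebra.
From mathcomp Require Import all_classical all_reals all_analysis.

Set Implicit Arguments.
Unset Strict Implicit.
Unset Printing Implicit Defensive.

Import Order.TTheory GRing.Theory Num.Theory.
Import numFieldNormedType.Exports.

Local Open Scope classical_set_scope.
Local Open Scope ring_scope.

(* R^m is 'cV[R]_m. Matrices carry the Borel sigma-algebra of their topology. *)
Section matrix_borel.
Context (R : realType) (m n : nat).

Definition mx_borel : set_system 'M[R]_(m, n) := <<s (@open 'M[R]_(m, n)) >>.

Let mx_borel0 : mx_borel set0.
Proof. exact: sigma_algebra0. Qed.

Let mx_borelC A : mx_borel A -> mx_borel (~` A).
Proof. exact: sigma_algebraC. Qed.

Let mx_borelU (F : (set 'M[R]_(m, n))^nat) :
  (forall i, mx_borel (F i)) -> mx_borel (\bigcup_i F i).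
Proof. exact: sigma_algebra_bigcup. Qed.

HB.instance Definition _ :=
  @isMeasurable.Build (sigma_display (@open 'M[R]_(m, n))) 'M[R]_(m, n)
    mx_borel mx_borel0 mx_borelC mx_borelU.

End matrix_borel.

(* Hilbert-Schmidt norm; on column vectors this is the Euclidean norm (the
   library norm on matrices is the max norm). *)
Definition hsnorm (R : realType) (m n : nat) (A : 'M[R]_(m, n)) : R :=
  Num.sqrt (\sum_(i < m) \sum_(j < n) A i j ^+ 2).

Definition dotv (R : realType) (d : nat) (x y : 'cV[R]_d) : R :=
  \sum_(i < d) x i ord0 * y i ord0.

Arguments hsnorm {R m n} A.
Arguments dotv {R d} x y.

Section wasserstein.
Context (R : realType) (d : nat).
Implicit Types mu nu : probability 'cV[R]_d R.

Definition finite_first_moment mu : Prop :=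
  (\int[mu]_x (hsnorm x)%:E < +oo)%E.

Definition coupling mu nu : set (probability ('cV[R]_d * 'cV[R]_d)%type R) :=
  [set pi | forall A, measurable A ->
    pi (A `*` setT) = mu A /\ pi (setT `*` A) = nu A].

Definition W1 mu nu : \bar R :=
  ereal_inf [set (\int[pi]_z (hsnorm (z.1 - z.2))%:E)%E | pi in coupling mu nu].

Definition delta0 : probability 'cV[R]_d R := \d_(0 : 'cV[R]_d).

End wasserstein.

Arguments finite_first_moment {R d} mu.
Arguments W1 {R d} mu nu.
Arguments delta0 {R d}.

(* The proof of 0 < N is what makes this a probability measure. *)
Definition empirical (R : realType) (d N : nat) (N0 : (0 < N)%N)
    (x : 'I_N -> 'cV[R]_d) : set 'cV[R]_d -> \bar R :=
  fun A => ((N%:R^-1)%:E * \sum_(j < N) \d_(x j) A)%E.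

Section empirical_probability.
Context (R : realType) (d N : nat) (N0 : (0 < N)%N) (x : 'I_N -> 'cV[R]_d).
Local Notation emp := (empirical N0 x).

Let emp0 : emp set0 = 0%E.
Proof. by rewrite /empirical big1 ?mule0// => j _; rewrite measure0. Qed.

Let emp_ge0 A : (0 <= emp A)%E.
Proof.
apply: mule_ge0; first by rewrite lee_fin invr_ge0 ler0n.
by apply: sume_ge0 => j _; exact: measure_ge0.
Qed.

Let emp_sigma_additive : semi_sigma_additive emp.
Proof.
move=> F mF tF mUF; rewrite /empirical.
rewrite [X in X @ _](_ : _ = (fun n => (N%:R^-1)%:E *
    \sum_(j < N) \sum_(0 <= i < n) \d_(x j) (F i))%E); last first.
  apply/funext => n; rewrite exchange_big/= ge0_sume_distrr// => i _.
  by apply: sume_ge0 => j _; exact: measure_ge0.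
apply: cvgeZl => //; apply: cvg_nnesum => j _.
  by apply: nearW => n; apply: sume_ge0 => i _; exact: measure_ge0.
exact: measure_semi_sigma_additive.
Qed.

HB.instance Definition _ := isMeasure.Build _ _ _ emp
  emp0 emp_ge0 emp_sigma_additive.

Let emp_setT : emp setT = 1%E.
Proof.
rewrite /empirical (eq_bigr (fun=> 1%E)); last by move=> j _; rewrite diracT.
rewrite sumEFin sumr_const card_ord -EFinM mulVf//.
by rewrite pnatr_eq0 -lt0n.
Qed.

HB.instance Definition _ := Measure_isProbability.Build _ _ _ emp emp_setT.

End empirical_probability.

Section stochastic_basis.
Context (R : realType) (dO : measure_display) (Om : measurableType dO).
Context (P : probability Om R).

(* Filtrations are indexed by R; only times t >= 0 are meaningful. *)
Definition complete_usual_filtration (F : R -> set_system Om) : Prop :=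
  [/\ measure_is_complete P,
      forall t : R, 0 <= t -> sigma_algebra setT (F t) /\ F t `<=` measurable,
      forall s t : R, 0 <= s -> s <= t -> F s `<=` F t,
      forall t : R, 0 <= t -> F t = \bigcap_(s in `]t, +oo[) F s
    & P.-negligible `<=` F 0].

Definition mutually_independent (I : finType) (G : I -> set_system Om) : Prop :=
  forall (J : {set I}) (A : I -> set Om), (forall j, j \in J -> G j (A j)) ->
    P (\bigcap_(j in [set` J]) A j) = (\prod_(j in J) P (A j))%E.

Definition iid (d : nat) (I : finType) (Y : I -> {RV P >-> 'cV[R]_d}) : Prop :=
  mutually_independent
    (fun i => preimage_set_system setT (Y i) measurable) /\
  forall i j A, measurable A -> distribution P (Y i) A = distribution P (Y j) A.

Definition process_sigma (d : nat) (B : R -> Om -> 'cV[R]_d) : set_system Om :=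
  <<s \bigcup_(t in `[0, +oo[) preimage_set_system setT (B t) measurable >>.

(* Standard d-dimensional Brownian motion relative to the filtration F; the law
   N(0, (t - s) I_d) of an increment is given by its values on measurable
   rectangles, normal_prob being parametrized by the standard deviation. *)
Definition brownian_motion (d : nat) (F : R -> set_system Om)
    (B : R -> Om -> 'cV[R]_d) : Prop :=
  [/\ {ae P, forall w, B 0 w = 0},
      {ae P, forall w, {within `[0, +oo[, continuous (fun t : R => B t w)}},
      forall t : R, 0 <= t ->
        preimage_set_system setT (B t) measurable `<=` F t,
      forall s t : R, 0 <= s -> s < t -> forall C A, F s C -> measurable A ->
        P (C `&` [set w | A (B t w - B s w)]) =
        (P C * P [set w | A (B t w - B s w)%R])%E
    & forall s t : R, 0 <= s -> s < t -> forall A : 'I_d -> set R,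
        (forall k, measurable (A k)) ->
        P [set w | forall k, A k ((B t w - B s w) k ord0)] =
        (\prod_(k < d) normal_prob 0 (Num.sqrt (t - s)) (A k))%E].

End stochastic_basis.

Arguments process_sigma {R dO Om d} B _.

Section tamed_euler.
Context (R : realType) (d m1 m2 : nat).
Context (b : 'cV[R]_d -> probability 'cV[R]_d R -> 'cV[R]_d)
  (sig : 'cV[R]_d -> probability 'cV[R]_d R -> 'M[R]_(d, m1))
  (sigbar : 'cV[R]_d -> probability 'cV[R]_d R -> 'M[R]_(d, m2)).
Context (sig0 sig1 alpha l h : R).

(* Real powers use powR, for which 0 `^ 0 = 1. *)
Definition tamed_euler_step (x : 'cV[R]_d) (mu : probability 'cV[R]_d R)
    (dB : 'cV[R]_d) (dBbar : 'cV[R]_m1) (dW : 'cV[R]_d) (dWbar : 'cV[R]_m2) :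
    'cV[R]_d :=
  x + (h / (1 + alpha * Num.sqrt h * hsnorm x `^ l)) *: b x mu
    + sig0 *: dB + sig x mu *m dBbar + sig1 *: dW + sigbar x mu *m dWbar.

Definition increment (Om : Type) (k : nat) (B : R -> Om -> 'cV[R]_k)
    (n : nat) (w : Om) : 'cV[R]_k :=
  B (n.+1%:R * h) w - B (n%:R * h) w.

(* X n i is the i-th particle at time n h, on the product of the two spaces. *)
Definition tamed_euler_scheme (N : nat) (N0 : (0 < N)%N) (OmB OmW : Type)
    (B : 'I_N -> R -> OmB -> 'cV[R]_d) (Bbar : 'I_N -> R -> OmB -> 'cV[R]_m1)
    (W : R -> OmW -> 'cV[R]_d) (Wbar : R -> OmW -> 'cV[R]_m2)
    (X0 : 'I_N -> OmB -> 'cV[R]_d)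
    (X : nat -> 'I_N -> OmB * OmW -> 'cV[R]_d) : Prop :=
  (forall i w, X 0%N i w = X0 i w.1) /\
  forall n i w, X n.+1 i w =
    tamed_euler_step (X n i w) (empirical N0 (fun j => X n j w))
      (increment (B i) n w.1) (increment (Bbar i) n w.1)
      (increment W n w.2) (increment Wbar n w.2).

End tamed_euler.

(* Main.v *)
(* Since the constant may depend on [h], no martingale property of the noise is
   needed: the step-size restriction makes the tamed drift alone a contraction up
   to a mean-field term,
   |x + eta b(x, mu)|^2 <= q |x|^2 + beta m^2 + c with q + beta < 1,
   where mu is the empirical measure and m its first moment, and the noise of one
   step is dominated by norms of Gaussian increments, whose moments do not depend
   on n.  A pathwise comparison with scalar recursions
   z' = rho z + w, rho = sqrt (q + beta), then reduces the claim to
   (rho z + w)^p <= rho z^p + (1 - rho)^(1 - p) w^p, a consequence of convexity. *)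

Require Import Defs.
From mathcomp Require Import all_boot all_order all_algebra.
From mathcomp Require Import all_classical all_reals all_analysis.
From mathcomp Require Import measurable_realfun ring lra.

Import Order.TTheory GRing.Theory Num.Theory.
Import numFieldNormedType.Exports.

Local Open Scope classical_set_scope.
Local Open Scope ring_scope.

Set Implicit Arguments.
Unset Strict Implicit.
Unset Printing Implicit Defensive.

(** * The Hilbert-Schmidt norm *)

(** The obstacle is the mean-field term. Taking the square root of the one-step bound termwise gives
    [sqrt q |x| + sqrt beta m], and for small [h] the factor [sqrt q + sqrt beta] exceeds 1 although
    [q + beta < 1]. The comparison therefore has two passes: the empirical mean is bounded along
    each path by two coupled linear recursions, and then enters the recursion of a single particle
    as a forcing term. Sums over particles occur only as averages, whose moments Jensen's inequality
    bounds by those of one particle; hence the constant does not depend on [N] either. *)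

Lemma CauchySchwarz_sum (R : realType) (I : finType) (a b : I -> R) :
  (\sum_i a i * b i) ^+ 2 <= (\sum_i a i ^+ 2) * (\sum_i b i ^+ 2).
Proof.
set A := \sum_i a i ^+ 2; set B := \sum_i b i ^+ 2; set C := \sum_i a i * b i.
have A0 : 0 <= A by apply: sumr_ge0 => i _; exact: sqr_ge0.
(* Multiplying the defect by [A] makes it a sum of squares without any division; if [A = 0], all
   [a i] vanish. *)
have : 0 <= A * (A * B - C ^+ 2).
  suff -> : A * (A * B - C ^+ 2) = \sum_i (A * b i - C * a i) ^+ 2.
    by apply: sumr_ge0 => i _; exact: sqr_ge0.
  transitivity (\sum_i (A ^+ 2 * b i ^+ 2 - 2 * A * C * (a i * b i)
      + C ^+ 2 * a i ^+ 2)); last by apply: eq_bigr => i _; ring.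
  by rewrite big_split/= sumrB -!mulr_sumr -/A -/B -/C; ring.
case: (eqVneq A 0) => [A_eq0 _|A_neq0].
  have a0 i : a i = 0.
    apply/eqP; rewrite -sqrf_eq0; move: A_eq0 => /eqP.
    rewrite psumr_eq0 => [/allP/(_ i)|j _]; last exact: sqr_ge0.
    by rewrite mem_index_enum => /(_ isT).
  by rewrite /C big1 => [|i _]; rewrite ?a0 ?mul0r// expr0n A_eq0 mul0r.
by rewrite pmulr_rge0 ?lt0r ?A_neq0// subr_ge0.
Qed.

Lemma sqrt_sum_sqrD (R : realType) (I : finType) (a b : I -> R) :
  Num.sqrt (\sum_i (a i + b i) ^+ 2) <=
  Num.sqrt (\sum_i a i ^+ 2) + Num.sqrt (\sum_i b i ^+ 2).
Proof.
have s0 (c : I -> R) : 0 <= \sum_i c i ^+ 2.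
  by apply: sumr_ge0 => i _; exact: sqr_ge0.
rewrite -ler_sqr ?nnegrE ?addr_ge0 ?sqrtr_ge0// sqr_sqrtr ?s0//.
rewrite sqrrD !sqr_sqrtr ?s0//.
under eq_bigr => i _ do rewrite sqrrD.
rewrite !big_split/= lerD2r lerD2l.
rewrite -mulr2n lerMn2r/=.
rewrite -sqrtrM ?s0// (le_trans (ler_norm _))// -sqrtr_sqr ler_sqrt ?mulr_ge0 ?s0//.
exact: CauchySchwarz_sum.
Qed.

Lemma hsnorm_ge0 (R : realType) (m n : nat) (A : 'M[R]_(m, n)) : 0 <= hsnorm A.
Proof. exact: sqrtr_ge0. Qed.

Lemma hsnormE (R : realType) (m n : nat) (A : 'M[R]_(m, n)) :
  hsnorm A = Num.sqrt (\sum_k A k.1 k.2 ^+ 2).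
Proof. by rewrite /hsnorm pair_bigA. Qed.

Lemma sqr_hsnorm (R : realType) (m n : nat) (A : 'M[R]_(m, n)) :
  hsnorm A ^+ 2 = \sum_i \sum_j A i j ^+ 2.
Proof.
by rewrite sqr_sqrtr// !sumr_ge0// => i _; apply: sumr_ge0 => j _; rewrite sqr_ge0.
Qed.

Lemma sqr_hsnorm_cV (R : realType) (d : nat) (x : 'cV[R]_d) :
  hsnorm x ^+ 2 = \sum_i x i ord0 ^+ 2.
Proof. by rewrite sqr_hsnorm; under eq_bigr do rewrite big_ord1. Qed.

Lemma hsnorm0 (R : realType) (m n : nat) : hsnorm (0 : 'M[R]_(m, n)) = 0.
Proof.
by rewrite hsnormE big1 ?sqrtr0// => k _; rewrite mxE expr0n.
Qed.

Lemma ler_hsnormD (R : realType) (m n : nat) (A B : 'M[R]_(m, n)) :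
  hsnorm (A + B) <= hsnorm A + hsnorm B.
Proof.
rewrite !hsnormE (le_trans _ (sqrt_sum_sqrD _ _))//.
by under eq_bigr do rewrite mxE.
Qed.

Lemma hsnormZ (R : realType) (m n : nat) (a : R) (A : 'M[R]_(m, n)) :
  hsnorm (a *: A) = `|a| * hsnorm A.
Proof.
rewrite !hsnormE -sqrtr_sqr -sqrtrM ?sqr_ge0// mulr_sumr.
by under eq_bigr do rewrite mxE exprMn.
Qed.

Lemma ler_hsnormM (R : realType) (m n p : nat) (A : 'M[R]_(m, n))
  (B : 'M[R]_(n, p)) : hsnorm (A *m B) <= hsnorm A * hsnorm B.
Proof.
rewrite -ler_sqr ?nnegrE ?mulr_ge0 ?hsnorm_ge0// exprMn !sqr_hsnorm mulr_suml.
apply: ler_sum => i _; rewrite exchange_big/= mulr_sumr.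
by apply: ler_sum => j _; rewrite mxE; exact: CauchySchwarz_sum.
Qed.

Lemma sqr_hsnormD (R : realType) (d : nat) (x y : 'cV[R]_d) :
  hsnorm (x + y) ^+ 2 = hsnorm x ^+ 2 + 2 * dotv x y + hsnorm y ^+ 2.
Proof.
rewrite !sqr_hsnorm_cV /dotv mulr_sumr -!big_split/=.
by apply: eq_bigr => i _; rewrite mxE; ring.
Qed.

Lemma dotvZr (R : realType) (d : nat) (a : R) (x y : 'cV[R]_d) :
  dotv x (a *: y) = a * dotv x y.
Proof. by rewrite /dotv mulr_sumr; apply: eq_bigr => i _; rewrite mxE; ring. Qed.

Lemma hsnorm_le_sum (R : realType) (d : nat) (x : 'cV[R]_d) :
  hsnorm x <= \sum_i `|x i ord0|.
Proof.
have s0 : 0 <= \sum_i `|x i ord0| by exact: sumr_ge0.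
rewrite -ler_sqr ?nnegrE ?hsnorm_ge0// sqr_hsnorm_cV [leRHS]expr2 mulr_sumr.
apply: ler_sum => i _; rewrite -real_normK ?num_real// expr2 ler_wpM2r//.
by rewrite (bigD1 i)//= lerDl; exact: sumr_ge0.
Qed.

(** * One step of the tamed drift *)

Ltac nonneg := repeat first [ done | exact: sqr_ge0 | exact: ltW | exact: ler0n
  | apply: addr_ge0 | apply: mulr_ge0 ].

(* Here [x], [T], [m], [inner], [B] stand for [|x|], [|x| ^ l], the first moment of
   the empirical measure, [<x, b>] and [|b|], and [s] for the square root of [h].
   Of the gap [lb1 - 2 lb2], the bound on [s] lets [eta ^ 2 |b| ^ 2] consume the
   fraction 3/4 through [|x| ^ 2] and at most 2/9 through [m ^ 2]; 1/36 is left. *)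
Lemma tamed_drift_ineq (R : realFieldType)
  (K lam2 b0 lb1 lb2 lb3 alpha s T x m inner B h eta Khat : R) :
  h = s ^+ 2 -> eta = h / (1 + alpha * s * T) -> Khat = 2 * K + lam2 + b0 ->
  0 < K -> 0 < lam2 -> 0 <= b0 -> 0 < lb2 -> 0 < lb3 -> 2 * lb2 < lb1 ->
  0 < alpha -> alpha <= 1 -> 0 < s -> s <= 1 ->
  h * lb1 <= 1 ->
  3 * Khat ^+ 2 * s * (1 + 2 * alpha) <=
    2 * alpha * (lb1 - 2 * lb2) ->
  0 <= T -> 0 <= x -> 0 <= m -> (1 <= x -> 1 <= T) -> (x < 1 -> T <= 1) ->
  inner <= - lb1 * (T * x ^+ 2) + lb2 * m ^+ 2 + lb3 ->
  0 <= B -> B <= K * (2 + T) * x + lam2 * m + b0 ->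
  x ^+ 2 + 2 * (eta * inner) + eta ^+ 2 * B ^+ 2 <=
  (1 - h * (lb1 - 3 / 4 * (lb1 - 2 * lb2))) * x ^+ 2
  + (2 * h * lb2 + h ^+ 2 * Khat * lam2) * m ^+ 2
  + (1 + 2 * h * lb3 + h ^+ 2 * Khat * (9 / 2 * K + b0)).
Proof.
move=> hE etaE KhatE K0 lam20 b00 lb20 lb30 lb12 al0 al1 s0 s1 hlb1 hs T0 x0 m0 xT xT' innerP B0 BP.
set D := lb1 - 2 * lb2; have D0 : 0 < D by rewrite /D subr_gt0.
have Khat0 : 0 < Khat by rewrite KhatE; lra.
have den0 : 0 < 1 + alpha * s * T by rewrite ltr_pwDl//; nonneg.
have h0 : 0 < h by rewrite hE exprn_gt0.
have eta0 : 0 < eta by rewrite etaE divr_gt0.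
have etah : eta <= h.
  by rewrite etaE ler_pdivrMr// ler_pMr// lerDl; nonneg.
(* Cauchy-Schwarz with weights [2 K], [lam2], [b0] on the values [(1 + T / 2) x], [m], 1. The
   weights sum to [Khat], and the defect is a sum of pairwise weighted squares. *)
have B2 : B ^+ 2 <= Khat * (2 * K * (1 + T / 2) ^+ 2 * x ^+ 2 + lam2 * m ^+ 2 + b0).
  apply: (@le_trans _ _ ((K * (2 + T) * x + lam2 * m + b0) ^+ 2)).
    by rewrite ler_sqr// nnegrE (le_trans B0).
  rewrite -subr_ge0 (_ : _ - _ = 2 * K * lam2 * ((1 + T / 2) * x - m) ^+ 2
    + 2 * K * b0 * ((1 + T / 2) * x - 1) ^+ 2 + lam2 * b0 * (m - 1) ^+ 2).
    by nonneg.
  by rewrite KhatE; field.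
have eta2B : eta ^+ 2 * B ^+ 2 <=
    2 * K * Khat * (eta * (1 + T / 2) * x) ^+ 2
    + h ^+ 2 * Khat * lam2 * m ^+ 2 + h ^+ 2 * Khat * b0.
  apply: le_trans (ler_wpM2l (sqr_ge0 _) B2) _.
  have e2 : eta ^+ 2 <= h ^+ 2 by rewrite ler_sqr// nnegrE ltW.
  rewrite -subr_ge0 (_ : _ - _ = (h ^+ 2 - eta ^+ 2) * (Khat * (lam2 * m ^+ 2 + b0)));
    last by ring.
  by rewrite mulr_ge0 ?subr_ge0//; nonneg.
have einner : eta * inner <=
    - lb1 * (eta * T) * x ^+ 2 + h * lb2 * m ^+ 2 + h * lb3.
  apply: le_trans (ler_wpM2l (ltW eta0) innerP) _.
  rewrite -subr_ge0 (_ : _ - _ = (h - eta) * (lb2 * m ^+ 2 + lb3)); last by ring.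
  by rewrite mulr_ge0 ?subr_ge0//; nonneg.
have lb1D : 0 < lb1 - 3 / 4 * D by rewrite /D; lra.
(* The terms in [m], [lb3] and [b0] already match; only powers of [x] remain to be compared. *)
suff H : x ^+ 2 - 2 * lb1 * (eta * T) * x ^+ 2
    + 2 * K * Khat * (eta * (1 + T / 2) * x) ^+ 2 <=
    (1 - h * (lb1 - 3 / 4 * D)) * x ^+ 2 + 1 + h ^+ 2 * Khat * (9 / 2 * K).
  rewrite -/D; lra.
have KK : 2 * K <= Khat by rewrite KhatE; lra.
(* For [1 <= x] coercivity pays for [|b| ^ 2]. For [x < 1] all terms are bounded, and the additive
   constant absorbs them. *)
have [x1|x1] := leP 1 x.
- have T1 := xT x1.
  set Y := eta * T; have Y0 : 0 < Y by rewrite mulr_gt0// (lt_le_trans ltr01).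
  have alsT : 0 <= alpha * s * T by nonneg.
  have etaD : eta * (1 + alpha * s * T) = h by rewrite etaE mulfVK// gt_eqF.
  have hY : h <= 2 * Y.
    rewrite -etaD /Y mulrCA ler_wpM2l ?(ltW eta0)//.
    have als : alpha * s <= 1 by rewrite mulr_ile1// ltW.
    have := ler_wpM2r T0 als; lra.
  (* The effect of the taming: [eta T <= h / (alpha s) = s / alpha], however large [T] is. *)
  have Ys : alpha * Y <= s.
    rewrite -(ler_pM2l s0) -expr2 -hE -etaD /Y -subr_ge0.
    rewrite (_ : _ - _ = eta); last by ring.
    exact: ltW.
  have Y32 : eta * (1 + T / 2) <= 3 / 2 * Y by rewrite /Y; nra.
  have Y2 : Khat ^+ 2 * Y <= 2 / 3 * D.
    rewrite -(ler_pM2l al0).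
    have K2 : 0 < Khat ^+ 2 by rewrite exprn_gt0.
    have := ler_wpM2l (ltW K2) Ys.
    have : 0 <= Khat ^+ 2 * s * alpha by nonneg.
    rewrite -/D in hs; lra.
  (* Origin of the fraction 3/4: the quadratic term costs at most [9/4 Khat ^ 2 Y ^ 2 <= 3/2 D Y],
     out of [2 lb1 Y]. What is left is [2 Y (lb1 - 3/4 D)], and [h <= 2 Y]. *)
  have KKY : 2 * K * Khat * (eta * (1 + T / 2)) ^+ 2 <= 3 / 2 * D * Y.
    apply: (@le_trans _ _ (Khat ^+ 2 * (3 / 2 * Y) ^+ 2)).
      apply: ler_pM; rewrite ?sqr_ge0//.
      - by nonneg.
      - by rewrite expr2 ler_wpM2r// ltW.
      - by rewrite ler_sqr ?nnegrE// mulr_ge0 ?(ltW eta0) ?(ltW Y0)//; lra.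
    have := ler_wpM2r (ltW Y0) Y2; lra.
  have a_le : h * (lb1 - 3 / 4 * D) <=
      2 * lb1 * Y - 2 * K * Khat * (eta * (1 + T / 2)) ^+ 2.
    have := ler_wpM2r (ltW lb1D) hY; lra.
  have := ler_wpM2r (sqr_ge0 x) a_le.
  have : 0 <= h ^+ 2 * Khat * (9 / 2 * K).
    by nonneg.
  rewrite exprMn; lra.
- have T1 := xT' x1.
  have x21 : x ^+ 2 <= 1 by rewrite expr_le1// ltW.
  have h1 : 2 * K * Khat * (eta * (1 + T / 2) * x) ^+ 2 <=
      h ^+ 2 * Khat * (9 / 2 * K).
    rewrite (_ : h ^+ 2 * _ * _ = 2 * K * Khat * (h * (3 / 2)) ^+ 2); last by field.
    apply: ler_wpM2l; first by nonneg.
    have : eta * (1 + T / 2) * x <= h * (3 / 2) * 1.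
      apply: ler_pM => //; rewrite ?mulr_ge0 ?(ltW eta0)// ?(ltW x1)//; first lra.
      by apply: ler_pM; rewrite ?(ltW eta0)//; lra.
    rewrite mulr1 ler_sqr// nnegrE ?mulr_ge0 ?(ltW eta0) ?(ltW h0)//; lra.
  have h2 : 0 <= 2 * lb1 * (eta * T) * x ^+ 2.
    by rewrite !mulr_ge0 ?sqr_ge0 ?(ltW eta0)//; lra.
  have h3 : h * (lb1 - 3 / 4 * D) * x ^+ 2 <= x ^+ 2.
    apply: ler_piMl; first exact: sqr_ge0.
    have := mulr_ge0 (ltW h0) (ltW D0); lra.
  lra.
Qed.

(** With [D = lb1 - 2 lb2], one has [q + beta = 1 - h D / 4 + h ^ 2 Khat lam2], and
    [h Khat lam2 <= 2/9 D] leaves a gap of [h D / 36]. *)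
Lemma tamed_contraction_factor (R : realFieldType)
  (K lam2 b0 lb1 lb2 alpha s h Khat : R) :
  h = s ^+ 2 -> Khat = 2 * K + lam2 + b0 ->
  0 < K -> 0 < lam2 -> 0 <= b0 -> 0 < lb2 -> 2 * lb2 < lb1 ->
  0 < alpha -> alpha <= 1 -> 0 < s -> s <= 1 -> h * lb1 <= 1 ->
  3 * Khat ^+ 2 * s * (1 + 2 * alpha) <= 2 * alpha * (lb1 - 2 * lb2) ->
  let q := 1 - h * (lb1 - 3 / 4 * (lb1 - 2 * lb2)) in
  let beta := 2 * h * lb2 + h ^+ 2 * Khat * lam2 in
  [/\ 0 <= q, 0 <= beta & q + beta < 1].
Proof.
move=> hE KhatE K0 lam20 b00 lb20 lb12 al0 al1 s0 s1 hlb1 hs q beta.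
set D := lb1 - 2 * lb2; have D0 : 0 < D by rewrite /D subr_gt0.
have h0 : 0 < h by rewrite hE exprn_gt0.
have Khat0 : 0 < Khat by rewrite KhatE; lra.
have hs1 : h <= s by rewrite hE expr2 ler_piMl// ltW.
have hD0 : 0 < h * D by rewrite mulr_gt0.
split.
- by rewrite /q -/D; lra.
- by rewrite /beta; nonneg.
- have KK : Khat * lam2 <= Khat ^+ 2.
    by rewrite expr2 ler_wpM2l ?(ltW Khat0)//; rewrite KhatE; lra.
  (* The ratio [2 alpha / (3 (1 + 2 alpha))] increases with [alpha] and equals 2/9 at
     [alpha = 1]. *)
  have Ks : Khat ^+ 2 * s <= 2 / 9 * D.
    have al : 0 < 3 * (1 + 2 * alpha) by lra.
    rewrite -(ler_pM2r al); apply: (@le_trans _ _ (2 * alpha * D)).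
      by move: hs; rewrite -/D; lra.
    have := ler_wpM2r (ltW D0) al1; lra.
  have : h * (Khat * lam2) <= 2 / 9 * D.
    apply: le_trans Ks; rewrite mulrC ler_pM//; nonneg.
  move/(ler_wpM2l (ltW h0)).
  rewrite /q /beta /D; rewrite /D in hD0; lra.
Qed.

(** The last bound, once squared, is the third entry of the minimum. *)
Lemma step_size_bound (R : realType) (Khat lb1 D alpha h : R) :
  0 < Khat -> 0 < lb1 -> 0 < D -> 0 < alpha -> 0 < h ->
  h <= Num.min 1 (Num.min (1 / lb1)
    (4 * alpha ^+ 2 * D ^+ 2 / (9 * Khat ^+ 4 * (1 + 2 * alpha) ^+ 2))) ->
  [/\ Num.sqrt h <= 1, h * lb1 <= 1 &
    3 * Khat ^+ 2 * Num.sqrt h * (1 + 2 * alpha) <= 2 * alpha * D].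
Proof.
move=> K0 lb10 D0 al0 h0; rewrite !le_min => /and3P[h1 hlb hK].
have al2 : 0 < 1 + 2 * alpha by lra.
split.
- by rewrite -sqrtr1 ler_sqrt.
- by rewrite -ler_pdivlMr.
- rewrite -ler_sqr ?nnegrE; [|by rewrite !mulr_ge0 ?sqr_ge0 ?sqrtr_ge0// ltW
    |by rewrite !mulr_ge0// ltW].
  rewrite !exprMn sqr_sqrtr ?(ltW h0)//.
  rewrite ler_pdivlMr ?mulr_gt0 ?exprn_gt0// in hK.
  lra.
Qed.

(** * Empirical measures and the Wasserstein distance to the Dirac mass *)

Lemma measurable_coord (R : realType) (m n : nat) (i : 'I_m) (j : 'I_n) :
  measurable_fun setT (fun A : 'M[R]_(m, n) => A i j).
Proof.
apply: (measurability _ (RGenOpens.measurableE R)) => _ [_ [a [b ->]] <-].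
rewrite setTI; apply: sub_sigma_algebra.
apply: open_comp; last exact: interval_open.
by move=> A _; exact: coord_continuous.
Qed.

(** Asking for measurable coordinates only lets differences of vector-valued maps be handled as real
    functions. *)
Lemma measurable_fun_hsnorm d (T : measurableType d) (R : realType) (k : nat)
  (f : T -> 'cV[R]_k) :
  (forall i, measurable_fun setT (fun w => f w i ord0)) ->
  measurable_fun setT (fun w => hsnorm (f w)).
Proof.
move=> mf; apply: (@measurableT_comp _ _ _ _ _ _ (@Num.sqrt R)).
  exact: continuous_measurable_fun (@sqrt_continuous R).
apply: measurable_sum => i; apply: measurable_sum => j.
by rewrite ord1; exact: measurable_funX.
Qed.

Lemma measurable_hsnorm (R : realType) (k : nat) :
  measurable_fun setT (@hsnorm R k 1).
Proof. by apply: measurable_fun_hsnorm => i; exact: measurable_coord. Qed.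

Lemma ge0_integral_empirical (R : realType) (d N : nat) (N0 : (0 < N)%N)
  (x : 'I_N -> 'cV[R]_d) (f : 'cV[R]_d -> \bar R) :
  measurable_fun setT f -> (forall y, 0 <= f y)%E ->
  (\int[empirical N0 x]_y f y = (N%:R^-1)%:E * \sum_(j < N) f (x j))%E.
Proof.
case: N N0 x => // N N0 x mf f0.
(* [msum] takes a sequence of measures indexed by [nat]; [inord] extends the family of particles,
   which requires [N] to be a successor. *)
pose m_ (k : nat) : {measure set 'cV[R]_d -> \bar R} := \d_(x (inord k)).
have N10 : 0 <= N.+1%:R^-1 :> R by rewrite invr_ge0.
rewrite (eq_measure_integral (mscale (NngNum N10) (msum m_ N.+1))); last first.
  move=> A _ _; rewrite /mscale/= /msum /empirical; congr (_ * _)%E.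
  by apply: eq_bigr => j _; rewrite /m_/= inord_val.
rewrite ge0_integral_mscale//= ge0_integral_measure_sum//.
congr (_ * _)%E; apply: eq_bigr => j _.
by rewrite integral_dirac// diracT mul1e inord_val.
Qed.

Lemma finite_first_moment_empirical (R : realType) (d N : nat) (N0 : (0 < N)%N)
  (x : 'I_N -> 'cV[R]_d) : finite_first_moment (empirical N0 x).
Proof.
rewrite /finite_first_moment ge0_integral_empirical; last 2 first.
- by apply/measurable_EFinP; exact: measurable_hsnorm.
- by move=> y; rewrite lee_fin hsnorm_ge0.
by rewrite sumEFin -EFinM ltry.
Qed.

Lemma finite_first_moment_delta0 (R : realType) (d : nat) :
  finite_first_moment (@delta0 R d).
Proof.
rewrite /finite_first_moment integral_dirac//; last first.
  by apply/measurable_EFinP; exact: measurable_hsnorm.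
by rewrite diracT mul1e ltry.
Qed.

Lemma W1_ge0 (R : realType) (d : nat) (mu nu : probability 'cV[R]_d R) :
  (0 <= W1 mu nu)%E.
Proof.
by apply: le_ereal_inf_tmp => _ [pi _ <-]; apply: integral_ge0 => z _; rewrite lee_fin hsnorm_ge0.
Qed.

(** The product coupling of [mu] and [delta0] has exactly this cost. *)
Lemma W1_delta0_le (R : realType) (d : nat) (mu : probability 'cV[R]_d R) :
  (W1 mu delta0 <= \int[mu]_x (hsnorm x)%:E)%E.
Proof.
have mdist : measurable_fun setT
    (fun z : 'cV[R]_d * 'cV[R]_d => (hsnorm (z.1 - z.2))%:E).
  apply/measurable_EFinP; apply: measurable_fun_hsnorm => i.
  under eq_fun do rewrite !mxE.
  apply: measurable_funB.
  - exact: measurableT_comp (measurable_coord _ _) measurable_fst.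
  - exact: measurableT_comp (measurable_coord _ _) measurable_snd.
apply: ge_ereal_inf; exists (\int[mu]_x (hsnorm x)%:E)%E => //.
exists (mu \x delta0)%E.
- move=> A mA; split.
    by rewrite /= product_measure1E// [X in (_ * X)%E]diracT mule1.
  by rewrite /= product_measure1E// [X in (X * _)%E]probability_setT mul1e.
rewrite fubini_tonelli1//; last by move=> z; rewrite lee_fin hsnorm_ge0.
apply: eq_integral => x _; rewrite /fubini_F integral_dirac//=.
  by rewrite diracT mul1e subr0.
exact: measurableT_comp mdist (pair1_measurable _).
Qed.

(** * Absolute moments of centered normal laws *)

Lemma measurable_fun_powR_comp d (T : measurableType d) (R : realType) (p : R)
  (f : T -> R) : measurable_fun setT f -> measurable_fun setT (fun x => f x `^ p).
Proof. exact: (@measurableT_comp _ _ _ _ _ _ (@powR R ^~ p)). Qed.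

(** Change of variables holds for the Radon-Nikodym derivative, which agrees almost everywhere with
    the density because both have the same integral over every measurable set. *)
Lemma ge0_integral_normal_prob (R : realType) (m s : R) (f : R -> \bar R) :
  measurable_fun setT f -> (forall x, 0 <= f x)%E ->
  (\int[normal_prob m s]_x f x =
   \int[lebesgue_measure]_x (f x * (normal_pdf m s x)%:E))%E.
Proof.
move=> mf f0.
have dom := normal_prob_dominates m s.
rewrite -(Radon_Nikodym_SigmaFinite.change_of_variables dom)//.
apply: ae_eq_integral => //.
- apply: emeasurable_funM => //.
  exact: measurable_int (Radon_Nikodym_SigmaFinite.f_integrable dom).
- by apply: emeasurable_funM => //; apply/measurable_EFinP; exact: measurable_normal_pdf.
- apply: ae_eqe_mul2l; apply: integral_ae_eq => //.
  + exact: Radon_Nikodym_SigmaFinite.f_integrable.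
  + by apply/measurable_EFinP; exact: measurable_normal_pdf.
  + by move=> E _ mE; rewrite -Radon_Nikodym_SigmaFinite.f_integral.
Qed.

(** From [u <= expR u] with [u = x ^ 2 / (2 p s ^ 2)], raised to the power [p / 2]. The scale of [u]
    is chosen so that the exponential uses up half of the Gaussian exponent [x ^ 2 / (2 s ^ 2)]. *)
Lemma powR_normr_le_expR (R : realType) (p s x : R) : 0 < p -> 0 < s ->
  `|x| `^ p <= (2 * p * s ^+ 2) `^ (p / 2) * expR (x ^+ 2 / (4 * s ^+ 2)).
Proof.
move=> p0 s0; have s20 : 0 < s ^+ 2 by rewrite exprn_gt0.
have c0 : 0 < 2 * p * s ^+ 2 by rewrite !mulr_gt0.
set u := x ^+ 2 / (2 * p * s ^+ 2).
have u0 : 0 <= u by rewrite divr_ge0 ?sqr_ge0// ltW.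
have -> : `|x| `^ p = (2 * p * s ^+ 2) `^ (p / 2) * u `^ (p / 2).
  rewrite -powRM ?(ltW c0)// mulrC /u mulfVK ?gt_eqF//.
  rewrite -real_normK ?num_real// -powR_mulrn// -powRrM; congr (_ `^ _).
  by field.
rewrite ler_wpM2l ?powR_ge0//.
have -> : x ^+ 2 / (4 * s ^+ 2) = (p / 2) * u.
  rewrite /u; field; rewrite gt_eqF// gt_eqF//.
rewrite [_ * u]mulrC expRM ge0_ler_powR ?nnegrE ?expR_ge0 ?u0 ?divr_ge0 ?(ltW p0)//.
by rewrite (le_trans _ (expR_ge1Dx u))// lerDr.
Qed.

Lemma normal_prob_moment_lty (R : realType) (p s : R) : 0 < p -> 0 < s ->
  (\int[normal_prob 0 s]_x (`|x| `^ p)%:E < +oo)%E.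
Proof.
move=> p0 s0.
have mpow : measurable_fun [set: R] (fun x => `|x| `^ p).
  by apply: measurable_fun_powR_comp; exact: normr_measurable.
rewrite ge0_integral_normal_prob//; last exact/measurable_EFinP.
(* The other half of the exponent is that of a normal density with variance [2 s ^ 2], so a multiple
   of this density dominates the integrand. *)
set s' := Num.sqrt 2 * s.
have s'0 : 0 < s' by rewrite mulr_gt0// sqrtr_gt0.
have s'2 : s' ^+ 2 = 2 * s ^+ 2 by rewrite exprMn sqr_sqrtr.
set c := (2 * p * s ^+ 2) `^ (p / 2) * normal_peak s / normal_peak s'.
have c0 : 0 <= c by rewrite !mulr_ge0 ?powR_ge0 ?invr_ge0 ?normal_peak_ge0.
have pdf_le x : `|x| `^ p * normal_pdf 0 s x <= c * normal_pdf 0 s' x.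
  rewrite !normal_pdfE ?gt_eqF// /c [leRHS]mulrA mulfVK ?gt_eqF ?normal_peak_gt0 ?gt_eqF//.
  rewrite mulrCA [leRHS]mulrAC -[leRHS]mulrC.
  rewrite ler_wpM2l ?normal_peak_ge0//.
  rewrite /normal_fun !subr0 s'2.
  rewrite (_ : - x ^+ 2 / (s ^+ 2 *+ 2) =
    - (x ^+ 2 / (4 * s ^+ 2)) + - x ^+ 2 / (2 * s ^+ 2 *+ 2)); last first.
    by field; rewrite gt_eqF.
  rewrite expRD mulrA ler_wpM2r ?expR_ge0// expRN ler_pdivrMr ?expR_gt0//.
  exact: powR_normr_le_expR.
apply: (@le_lt_trans _ _ (\int[lebesgue_measure]_x (c%:E * (normal_pdf 0 s' x)%:E))%E).
  apply: ge0_le_integral => //.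
  - by move=> x _; rewrite -EFinM lee_fin mulr_ge0 ?powR_ge0 ?normal_pdf_ge0.
  - by apply/measurable_EFinP/measurable_funM => //; exact: measurable_normal_pdf.
  - by apply/measurable_EFinP/measurable_funM => //; exact: measurable_normal_pdf.
  - by move=> x _; rewrite -!EFinM lee_fin.
rewrite ge0_integralZl_EFin//; last 2 first.
- by move=> x _; rewrite lee_fin normal_pdf_ge0.
- by apply/measurable_EFinP; exact: measurable_normal_pdf.
by rewrite integral_normal_pdf mule1 ltry.
Qed.

(** * Pathwise comparison *)

Lemma powR_conv (R : realType) (p t x y : R) : 1 <= p -> 0 <= t -> t <= 1 ->
  0 <= x -> 0 <= y ->
  (t * x + (1 - t) * y) `^ p <= t * x `^ p + (1 - t) * y `^ p.
Proof.
move=> p1 t0 t1 x0 y0.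
by apply: (convex_powR p1 (Itv01 t0 t1)); rewrite ?inE/= ?in_itv/= ?andbT.
Qed.

(** Convexity at the points [z] and [w / (1 - rho)] with weights [rho] and [1 - rho]: the
    coefficient of the p-th power of [z] stays below 1. *)
Lemma powR_contraction (R : realType) (p rho z w : R) :
  1 <= p -> 0 <= rho -> rho < 1 -> 0 <= z -> 0 <= w ->
  (rho * z + w) `^ p <=
  rho * z `^ p + (1 - rho) * (1 - rho)^-1 `^ p * w `^ p.
Proof.
move=> p1 rho0 rho1 z0 w0.
have r1 : 0 < 1 - rho by rewrite subr_gt0.
have w1 : 0 <= (1 - rho)^-1 * w by rewrite mulr_ge0// invr_ge0 ltW.
have := powR_conv p1 rho0 (ltW rho1) z0 w1.
by rewrite mulVKf ?gt_eqF// [in leRHS]powRM ?invr_ge0 ?(ltW r1)// mulrA.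
Qed.

Lemma powRD_le (R : realType) (p a b : R) : 1 <= p -> 0 <= a -> 0 <= b ->
  (a + b) `^ p <= 2 `^ p * (a `^ p + b `^ p).
Proof.
move=> p1 a0 b0.
have h0 : 0 <= 2^-1 :> R by rewrite invr_ge0.
have h1 : 2^-1 <= 1 :> R by rewrite invf_le1// ler1n.
have := powR_conv p1 h0 h1 (mulr_ge0 (ler0n R 2) a0) (mulr_ge0 (ler0n R 2) b0).
rewrite !powRM// (_ : _ + _ = a + b); last by field.
have : 0 <= 2 `^ p * a `^ p by rewrite mulr_ge0 ?powR_ge0.
have : 0 <= 2 `^ p * b `^ p by rewrite mulr_ge0 ?powR_ge0.
lra.
Qed.

(** Jensen's inequality, by induction: the mean of [N + 2] numbers is a convex combination of the
    mean of the first [N + 1] and the last one. *)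
Lemma powR_mean_le (R : realType) (p : R) (N : nat) (a : 'I_N -> R) :
  1 <= p -> (0 < N)%N -> (forall i, 0 <= a i) ->
  (N%:R^-1 * \sum_i a i) `^ p <= N%:R^-1 * \sum_i a i `^ p.
Proof.
case: N a => // N a p1 _; elim: N a => [|N IH] a a0.
  by rewrite !big_ord1 invr1 !mul1r.
rewrite [\sum_i a i]big_ord_recr [\sum_i a i `^ p]big_ord_recr/=.
set s := \sum_i a (widen_ord _ i); set b := a ord_max.
have s0 : 0 <= s by apply: sumr_ge0 => i _.
have N2 : N.+2%:R != 0 :> R by rewrite pnatr_eq0.
have N1 : N.+1%:R != 0 :> R by rewrite pnatr_eq0.
have t0 : 0 <= N.+1%:R / N.+2%:R :> R by rewrite divr_ge0.
have t1 : N.+1%:R / N.+2%:R <= 1 :> R by rewrite ler_pdivrMr ?ltr0n// mul1r ler_nat.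
have tE : 1 - N.+1%:R / N.+2%:R = N.+2%:R^-1 :> R.
  apply: (mulIf N2); rewrite mulrBl mulfVK// mulVf// mul1r.
  by rewrite -[N.+2]addn1 natrD addrAC subrr add0r.
have meanE (x y : R) : N.+2%:R^-1 * (x + y) =
    N.+1%:R / N.+2%:R * (N.+1%:R^-1 * x) + (1 - N.+1%:R / N.+2%:R) * y.
  by rewrite tE mulrDr; congr (_ + _); field; apply/andP.
rewrite !meanE; apply: le_trans (powR_conv p1 t0 t1 _ (a0 _)) _.
  by rewrite mulr_ge0 ?invr_ge0.
rewrite lerD2r ler_wpM2l//; exact: IH.
Qed.

Lemma mean_sqr_le (R : realType) (N : nat) (v : 'I_N -> R) :
  (N%:R^-1 * \sum_i v i) ^+ 2 <= N%:R^-1 * \sum_i v i ^+ 2.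
Proof.
case: N v => [|N] v; first by rewrite !big_ord0 !mulr0 expr0n.
have := CauchySchwarz_sum v (fun=> 1).
under eq_bigr do rewrite mulr1.
rewrite expr1n sumr_const card_ord => H.
rewrite exprMn expr2 -mulrA ler_wpM2l// ler_pdivrMl ?ltr0n//.
by rewrite mulrC.
Qed.

Fixpoint linrec (R : realType) (rho x0 : R) (w : nat -> R) (n : nat) : R :=
  if n is n'.+1 then rho * linrec rho x0 w n' + w n' else x0.

Lemma linrec_ge0 (R : realType) (rho x0 : R) (w : nat -> R) (n : nat) :
  0 <= rho -> 0 <= x0 -> (forall k, 0 <= w k) -> 0 <= linrec rho x0 w n.
Proof. by move=> ? ? ?; elim: n => //= n IH; rewrite addr_ge0// mulr_ge0. Qed.

Lemma le_linrec (R : realType) (rho x0 : R) (w z : nat -> R) (n : nat) :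
  0 <= rho -> z 0%N <= x0 -> (forall k, z k.+1 <= rho * z k + w k) ->
  z n <= linrec rho x0 w n.
Proof.
move=> rho0 z0 zS; elim: n => //= n IH.
by rewrite (le_trans (zS n))// lerD2r ler_wpM2l.
Qed.

(* Splitting the particles as [r <= u + v], where [u] is controlled in the mean and
   [v] in mean square, decouples the system: the initial data and the noise only
   feed [u], and the mean-field term only feeds [v].  This is what makes the
   estimate uniform in [N] also for exponents below [2]. *)
Lemma mean_le_linrec (R : realType) (N : nat) (q beta : R)
  (r e : nat -> 'I_N -> R) (n : nat) :
  let mean (a : 'I_N -> R) := N%:R^-1 * \sum_i a i in
  let rho := Num.sqrt (q + beta) in
  let U := linrec rho (mean (r 0%N)) (fun k => mean (e k)) in
  let V := linrec rho 0 (fun k => rho * U k) in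
  0 <= q -> 0 <= beta -> (forall k i, 0 <= r k i) -> (forall k i, 0 <= e k i) ->
  (forall k i, r k.+1 i <=
    Num.sqrt (q * r k i ^+ 2 + beta * mean (r k) ^+ 2) + e k i) ->
  mean (r n) <= U n + V n.
Proof.
move=> mean rho U V q0 beta0 r0 e0 rS.
have qb0 : 0 <= q + beta by exact: addr_ge0.
have rho0 : 0 <= rho by exact: sqrtr_ge0.
have rho2 : rho ^+ 2 = q + beta by rewrite sqr_sqrtr.
have N0 : 0 <= N%:R^-1 :> R by rewrite invr_ge0.
have mean_ge0 a : (forall i, 0 <= a i) -> 0 <= mean a.
  by move=> a0; rewrite mulr_ge0// sumr_ge0.
have mean_le a a' : (forall i, a i <= a' i) -> mean a <= mean a'.
  by move=> aa'; rewrite ler_wpM2l// ler_sum.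
have meanD a a' : mean (fun i => a i + a' i) = mean a + mean a'.
  by rewrite /mean big_split mulrDr.
have meanZ c a : mean (fun i => c * a i) = c * mean a.
  by rewrite /mean -mulr_sumr mulrCA.
(* An inequality only, since for [N = 0] the mean of a constant is 0. *)
have mean_cst (c : R) : 0 <= c -> mean (fun=> c) <= c.
  move=> c0; rewrite /mean sumr_const card_ord -(mulr_natr c) mulrCA.
  by apply: ler_piMr => //; case: (N) => [|N']; rewrite ?mulr0// mulVf.
have U0 k : 0 <= U k by apply: linrec_ge0 => // [|j]; exact: mean_ge0.
have V0 k : 0 <= V k by apply: linrec_ge0 => // j; exact: mulr_ge0.
suff [u [v [u0 v0 ruv uU vV]]] : exists u v : 'I_N -> R,
    [/\ forall i, 0 <= u i, forall i, 0 <= v i, forall i, r n i <= u i + v i,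
      mean u <= U n & mean (fun i => v i ^+ 2) <= V n ^+ 2].
  rewrite (le_trans (mean_le _ _ ruv))// meanD lerD//.
  by rewrite -ler_sqr ?nnegrE ?mean_ge0// (le_trans (mean_sqr_le v)).
elim: n => [|n [u [v [u0 v0 ruv uU vV]]]].
  exists (r 0%N), (fun=> 0); split => //.
  - by move=> i; rewrite addr0.
  - by rewrite /mean big1 ?mulr0 ?expr0n// => i _; rewrite expr0n.
set m := mean (r n).
have m0 : 0 <= m by exact: mean_ge0.
have mUV : m <= U n + V n.
  rewrite /m (le_trans (mean_le _ _ ruv))// meanD lerD//.
  by rewrite -ler_sqr ?nnegrE ?mean_ge0// (le_trans (mean_sqr_le v)).
have {rS}rS i : r n.+1 i <= Num.sqrt (q * r n i ^+ 2 + beta * m ^+ 2) + e n i.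
  exact: rS.
clearbody m.
have s0 i : 0 <= q * v i ^+ 2 + beta * m ^+ 2.
  by rewrite addr_ge0// mulr_ge0// sqr_ge0.
(* Minkowski's inequality in the plane: [(sqrt q (u + v), sqrt beta m)] is the sum of
   [(sqrt q u, 0)] and [(sqrt q v, sqrt beta m)]. The mean of the new [u] is controlled through
   [sqrt q <= rho], and the mean square of the new [v] through [q V ^ 2 + beta (U + V) ^ 2 <= (rho
   (U + V)) ^ 2], which dictates the recursion of [V]. *)
exists (fun i => Num.sqrt q * u i + e n i),
  (fun i => Num.sqrt (q * v i ^+ 2 + beta * m ^+ 2)); split.
- by move=> i; rewrite addr_ge0// mulr_ge0// sqrtr_ge0.
- by move=> i; rewrite sqrtr_ge0.
- move=> i /=; rewrite (le_trans (rS i))// addrAC lerD2r.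
  rewrite -ler_sqr ?nnegrE ?addr_ge0 ?mulr_ge0 ?sqrtr_ge0// sqr_sqrtr; last first.
    by rewrite addr_ge0// mulr_ge0// sqr_ge0.
  rewrite sqrrD sqr_sqrtr// exprMn sqr_sqrtr//.
  have : r n i ^+ 2 <= (u i + v i) ^+ 2 by rewrite ler_sqr ?nnegrE// addr_ge0.
  move=> /(ler_wpM2l q0).
  have : q * v i * u i <=
      Num.sqrt q * u i * Num.sqrt (q * v i ^+ 2 + beta * m ^+ 2).
    rewrite mulrAC -{1}(sqr_sqrtr q0) expr2 -!mulrA ler_wpM2l ?sqrtr_ge0//.
    rewrite mulrCA ler_wpM2l// -ler_sqr ?nnegrE ?mulr_ge0 ?sqrtr_ge0//.
    by rewrite sqr_sqrtr// exprMn sqr_sqrtr// lerDl mulr_ge0// sqr_ge0.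
  lra.
- rewrite (_ : mean _ = Num.sqrt q * mean u + mean (e n)); last first.
    by rewrite -meanZ -meanD.
  rewrite lerD2r ler_pM ?mean_ge0 ?sqrtr_ge0//.
  by rewrite ler_sqrt// lerDl.
- rewrite /mean; under eq_bigr do rewrite sqr_sqrtr//.
  rewrite big_split/= -mulr_sumr mulrDr mulrCA -/(mean _) -/(mean _).
  have -> : V n.+1 = rho * (V n + U n) by rewrite mulrDr.
  rewrite exprMn rho2 mulrDl addrC [leRHS]addrC lerD//.
    rewrite (le_trans (mean_cst _ _)) ?mulr_ge0 ?sqr_ge0//.
    by rewrite ler_wpM2l// ler_sqr ?nnegrE ?addr_ge0// addrC.
  rewrite ler_wpM2l// (le_trans vV)// ler_sqr ?nnegrE ?addr_ge0//.
  by rewrite lerDl.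
Qed.

(** For one particle whose mean field is already controlled, [m] is mere forcing, and only the
    factor of [x] has to be below 1. Averaged over the particles, this bound would give the useless
    factor [2 rho]. *)
Lemma sqrt_mean_field_le (R : realType) (q beta x m : R) :
  0 <= q -> 0 <= beta -> 0 <= x -> 0 <= m ->
  Num.sqrt (q * x ^+ 2 + beta * m ^+ 2) <= Num.sqrt (q + beta) * (x + m).
Proof.
move=> q0 b0 x0 m0.
have xm : 0 <= x + m by exact: addr_ge0.
rewrite -[x + m]ger0_norm// -sqrtr_sqr -sqrtrM ?addr_ge0// ler_sqrt.
  rewrite mulrDl lerD// ler_wpM2l// ler_sqr ?nnegrE// ?lerDl ?lerDr//.
by rewrite mulr_ge0 ?addr_ge0 ?sqr_ge0.
Qed.

(** * Moments of contractive recursions *)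

(** Measurability, sign and a real bound are bundled so that moment estimates compose without side
    conditions on integrability. *)
Definition moment_le d (T : measurableType d) (R : realType)
    (P : probability T R) (p : R) (f : T -> R) (A : R) : Prop :=
  [/\ measurable_fun setT f, forall t, 0 <= f t &
    (\int[P]_t (f t `^ p)%:E <= A%:E)%E].

Lemma moment_le_ge0 d (T : measurableType d) (R : realType)
  (P : probability T R) (p : R) (f : T -> R) (A : R) :
  moment_le P p f A -> 0 <= A.
Proof.
case=> _ _ fA; rewrite -lee_fin (le_trans _ fA)//.
by apply: integral_ge0 => t _; rewrite lee_fin powR_ge0.
Qed.

Lemma measurable_powR_EFin d (T : measurableType d) (R : realType) (p : R)
  (f : T -> R) : measurable_fun setT f ->
  measurable_fun setT (fun x => (f x `^ p)%:E).
Proof. by move=> mf; apply/measurable_EFinP; exact: measurable_fun_powR_comp. Qed.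

Lemma moment_le_le d (T : measurableType d) (R : realType)
  (P : probability T R) (p : R) (f g : T -> R) (A : R) :
  0 <= p -> moment_le P p g A -> measurable_fun setT f ->
  (forall t, 0 <= f t) -> (forall t, f t <= g t) -> moment_le P p f A.
Proof.
move=> p0 [mg g0 gA] mf f0 fg; split; [exact: mf|exact: f0|].
apply: le_trans gA.
apply: ge0_le_integral => //.
- by move=> t _; rewrite lee_fin powR_ge0.
- exact: measurable_powR_EFin.
- exact: measurable_powR_EFin.
- by move=> t _; rewrite lee_fin ge0_ler_powR ?nnegrE.
Qed.

Lemma moment_le_cst d (T : measurableType d) (R : realType)
  (P : probability T R) (p c : R) : 0 <= c -> moment_le P p (fun=> c) (c `^ p).
Proof.
by move=> c0; split => //; rewrite integral_cst// [X in (_ * X)%E]probability_setT mule1.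
Qed.

Lemma moment_leZ d (T : measurableType d) (R : realType)
  (P : probability T R) (p c : R) (f : T -> R) (A : R) : 0 <= c ->
  moment_le P p f A -> moment_le P p (fun t => c * f t) (c `^ p * A).
Proof.
move=> c0 [mf f0 fA]; split; first exact: measurable_funM.
  by move=> t; exact: mulr_ge0.
under eq_integral do rewrite powRM// EFinM.
rewrite ge0_integralZl_EFin ?powR_ge0//; last 2 first.
- by move=> t _; rewrite lee_fin powR_ge0.
- exact: measurable_powR_EFin.
by rewrite EFinM lee_pmul ?lee_fin ?powR_ge0//
  integral_ge0// => t _; rewrite lee_fin powR_ge0.
Qed.

(** Comparing p-th powers pointwise serves both [powRD_le] and [powR_contraction]. *)
Lemma moment_le_lincomb d (T : measurableType d) (R : realType)
  (P : probability T R) (p a b : R) (f g1 g2 : T -> R) (A1 A2 : R) :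
  0 <= a -> 0 <= b -> moment_le P p g1 A1 -> moment_le P p g2 A2 ->
  measurable_fun setT f -> (forall t, 0 <= f t) ->
  (forall t, f t `^ p <= a * g1 t `^ p + b * g2 t `^ p) ->
  moment_le P p f (a * A1 + b * A2).
Proof.
move=> a0 b0 [mg1 g10 gA1] [mg2 g20 gA2] mf f0 fg; split => //.
have mag c (g : T -> R) : measurable_fun setT g ->
    measurable_fun setT (fun t => (c * g t `^ p)%:E).
  move=> mg; apply/measurable_EFinP/measurable_funM => //.
  exact: measurable_fun_powR_comp.
apply: (@le_trans _ _ (\int[P]_t ((a * g1 t `^ p)%:E + (b * g2 t `^ p)%:E))%E).
  apply: ge0_le_integral => //.
  - by move=> t _; rewrite lee_fin powR_ge0.
  - exact: measurable_powR_EFin.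
  - by apply: emeasurable_funD; exact: mag.
  - by move=> t _; rewrite -EFinD lee_fin.
rewrite ge0_integralD//; last 4 first.
- by move=> t _; rewrite lee_fin mulr_ge0 ?powR_ge0.
- exact: mag.
- by move=> t _; rewrite lee_fin mulr_ge0 ?powR_ge0.
- exact: mag.
have scale c (g : T -> R) B : 0 <= c -> measurable_fun setT g ->
    (\int[P]_t (g t `^ p)%:E <= B%:E)%E ->
    (\int[P]_t (c * g t `^ p)%:E <= (c * B)%:E)%E.
  move=> c0 mg gB; under eq_integral do rewrite EFinM.
  rewrite ge0_integralZl_EFin//; last 2 first.
  - by move=> t _; rewrite lee_fin powR_ge0.
  - exact: measurable_powR_EFin.
  by rewrite EFinM lee_wpmul2l// lee_fin.
by rewrite EFinD leeD// scale.
Qed.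

Lemma moment_leD d (T : measurableType d) (R : realType)
  (P : probability T R) (p : R) (f g : T -> R) (A B : R) : 1 <= p ->
  moment_le P p f A -> moment_le P p g B ->
  moment_le P p (fun t => f t + g t) (2 `^ p * (A + B)).
Proof.
move=> p1 fA gB; have [[mf f0 _] [mg g0 _]] := (fA, gB).
rewrite mulrDr; apply: (moment_le_lincomb _ _ fA gB); rewrite ?powR_ge0//.
- exact: measurable_funD.
- by move=> t; exact: addr_ge0.
- by move=> t; rewrite -mulrDr; exact: powRD_le.
Qed.

Lemma moment_le_mean d (T : measurableType d) (R : realType)
  (P : probability T R) (p : R) (N : nat) (f : 'I_N -> T -> R) (A : R) :
  1 <= p -> (0 < N)%N -> (forall i, moment_le P p (f i) A) ->
  moment_le P p (fun t => N%:R^-1 * \sum_i f i t) A.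
Proof.
move=> p1 N0 fA.
have mf i : measurable_fun setT (f i) by case: (fA i).
have f0 i t : 0 <= f i t by case: (fA i).
have fAi i : (\int[P]_t (f i t `^ p)%:E <= A%:E)%E by case: (fA i).
have Ni0 : 0 <= N%:R^-1 :> R by rewrite invr_ge0.
have ms : measurable_fun setT (fun t => \sum_i f i t) by exact: measurable_sum.
split.
- exact: measurable_funM.
- by move=> t; rewrite mulr_ge0// sumr_ge0.
- apply: (@le_trans _ _ (\int[P]_t ((N%:R^-1)%:E * \sum_i (f i t `^ p)%:E))%E).
    apply: ge0_le_integral => //.
    + by move=> t _; rewrite lee_fin powR_ge0.
    + by apply: measurable_powR_EFin; exact: measurable_funM.
    + apply: emeasurable_funM => //; apply: emeasurable_sum => i.
      exact: measurable_powR_EFin.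
    + by move=> t _; rewrite sumEFin -EFinM lee_fin powR_mean_le.
  rewrite ge0_integralZl_EFin//; last 2 first.
  + by move=> t _; apply: sume_ge0 => i _; rewrite lee_fin powR_ge0.
  + by apply: emeasurable_sum => i; exact: measurable_powR_EFin.
  rewrite ge0_integral_sum//; last 2 first.
  + by move=> i; exact: measurable_powR_EFin.
  + by move=> i t _; rewrite lee_fin powR_ge0.
  apply: (@le_trans _ _ ((N%:R^-1)%:E * \sum_(i < N) A%:E)%E).
    by rewrite lee_wpmul2l ?lee_fin//; exact: lee_sum.
  rewrite sumEFin sumr_const card_ord -EFinM -(mulr_natr A) mulrCA mulVf ?mulr1//.
  by rewrite pnatr_eq0 -lt0n.
Qed.

Lemma moment_le_sum d (T : measurableType d) (R : realType)
  (P : probability T R) (p : R) (N : nat) (f : 'I_N -> T -> R) (A : R) :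
  1 <= p -> (forall i, moment_le P p (f i) A) ->
  moment_le P p (fun t => \sum_i f i t) (N%:R `^ p * A).
Proof.
case: N f => [|N] f p1 fA.
  (* The empty sum: the factor [N%:R] to the power [p] is then 0 because [p] is nonzero. *)
  under eq_fun do rewrite big_ord0.
  have := moment_le_cst P p (lexx (0 : R)).
  by rewrite powR0 ?mul0r// gt_eqF// (lt_le_trans ltr01).
have := moment_leZ (ler0n R N.+1) (moment_le_mean p1 (ltn0Sn N) fA).
by under eq_fun do rewrite mulrA mulfV ?pnatr_eq0// mul1r.
Qed.

(** The coefficient of the noise in [powR_contraction] times the sum of the geometric series of
    ratio [rho]; for [rho < 1] it equals [(1 - rho) ^ (- p)]. *)
Definition contraction_const (R : realType) (p rho : R) : R :=
  (1 - rho) * (1 - rho)^-1 `^ p / (1 - rho).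

(** One step sends a moment bound [M] to [rho M + J A], where [J] is [1 - rho] times
    [contraction_const p rho]. The stated bound is not increased by this map, hence the uniformity
    in [n]. *)
Lemma moment_le_linrec d (T : measurableType d) (R : realType)
  (P : probability T R) (p rho : R) (x0 : T -> R) (w : nat -> T -> R)
  (A0 A : R) (n : nat) : 1 <= p -> 0 <= rho -> rho < 1 ->
  moment_le P p x0 A0 -> (forall k, moment_le P p (w k) A) ->
  moment_le P p (fun t => linrec rho (x0 t) (w ^~ t) n)
    (A0 + contraction_const p rho * A).
Proof.
move=> p1 rho0 rho1 xA wA.
have r1 : 0 < 1 - rho by rewrite subr_gt0.
have A00 := moment_le_ge0 xA; have A_ge0 := moment_le_ge0 (wA 0%N).
set J := (1 - rho) * (1 - rho)^-1 `^ p.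
have J0 : 0 <= J by rewrite mulr_ge0 ?powR_ge0// ltW.
have w0 k t : 0 <= w k t by case: (wA k).
have x00 t : 0 <= x0 t by case: xA.
have cE : J / (1 - rho) * (1 - rho) = J by rewrite mulfVK// gt_eqF.
elim: n => [|n IH].
  case: xA => mx _ xA; split => //; apply: le_trans xA _.
  by rewrite lee_fin lerDl !mulr_ge0 ?powR_ge0 ?invr_ge0// ltW.
have := moment_le_lincomb rho0 J0 IH (wA n).
move/(_ (fun t => linrec rho (x0 t) (w ^~ t) n.+1)).
have [mz z0 _] := IH; have [mw _ _] := wA n.
case => [| |t|mz' z0' zA]; first by apply: measurable_funD => //; exact: measurable_funM.
- by move=> t; rewrite linrec_ge0.
- exact: powR_contraction.
split => //; apply: le_trans zA _.
rewrite lee_fin /contraction_const -/J mulrDr -addrA lerD//.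
  by rewrite ler_piMl// ltW.
rewrite -[leRHS](_ : rho * (J / (1 - rho) * A) + J * A = _)// -{2}cE; ring.
Qed.

Lemma mean_field_moment (R : realType) (p q beta Ae : R) :
  1 <= p -> 0 <= q -> 0 <= beta -> q + beta < 1 ->
  exists2 C : R, 0 < C &
  forall d (T : measurableType d) (P : probability T R) (N : nat)
    (r e : nat -> 'I_N -> T -> R) (A0 : R), (0 < N)%N ->
    (forall n i, measurable_fun setT (r n i)) -> (forall n i t, 0 <= r n i t) ->
    (forall n i, moment_le P p (e n i) Ae) ->
    (forall i, moment_le P p (r 0%N i) A0) ->
    (forall n i t, r n.+1 i t <= Num.sqrt (q * r n i t ^+ 2 +
      beta * (N%:R^-1 * \sum_j r n j t) ^+ 2) + e n i t) ->
    forall n i, moment_le P p (r n i) (C * (1 + A0)).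
Proof.
move=> p1 q0 beta0 qb1.
have p0 : 0 <= p by rewrite (le_trans ler01).
set rho := Num.sqrt (q + beta).
have rho0 : 0 <= rho by exact: sqrtr_ge0.
have rho1 : rho < 1 by rewrite -sqrtr1 ltr_sqrt.
set k := contraction_const p rho.
have k0 : 0 <= k.
  have r1 : 0 <= 1 - rho by rewrite subr_ge0 ltW.
  by rewrite !mulr_ge0 ?powR_ge0 ?invr_ge0.
(* Moment bounds for [U], for [V] and for the forcing [rho (U + V) + e] of one particle. All are
   affine in [A0], and [c1] is the slope of the last one. *)
pose AU A0 := A0 + k * Ae.
pose AV A0 := k * (rho `^ p * AU A0).
pose Aw A0 := 2 `^ p * (rho `^ p * (2 `^ p * (AU A0 + AV A0)) + Ae).
pose c1 := Aw 1 - Aw 0.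
(* The absolute values make the constant positive whatever the sign of [Ae]. *)
exists (2 + k * `|c1| + k * `|Aw 0|).
  by rewrite -addrA ltr_pwDl// addr_ge0// mulr_ge0.
move=> d T P N r e A0 N0 mr r0 eA rA rS n i.
have e0 j l t : 0 <= e j l t by case: (eA j l).
have A00 : 0 <= A0 := moment_le_ge0 (rA i).
pose U j t := linrec rho (N%:R^-1 * \sum_l r 0%N l t)
  (fun a => N%:R^-1 * \sum_l e a l t) j.
pose V j t := linrec rho 0 (fun a => rho * U a t) j.
have UA j : moment_le P p (U j) (AU A0).
  apply: (moment_le_linrec (w := fun a t => N%:R^-1 * \sum_l e a l t)) => //.
    exact: moment_le_mean.
  by move=> a; exact: moment_le_mean.
have VA j : moment_le P p (V j) (AV A0).
  rewrite /AV -[X in moment_le _ _ _ X]add0r.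
  apply: (moment_le_linrec (x0 := fun=> 0) (w := fun a t => rho * U a t)) => //.
    have := moment_le_cst P p (lexx (0 : R)).
    by rewrite powR0// gt_eqF// (lt_le_trans ltr01).
  by move=> a; exact: moment_leZ.
have wA j : moment_le P p (fun t => rho * (U j t + V j t) + e j i t) (Aw A0).
  by apply: moment_leD => //; apply: moment_leZ => //; exact: moment_leD.
(* Second pass: the mean is replaced by its bound [U + V], which leaves a scalar recursion for
   particle [i] alone. *)
have rle t : r n i t <=
    linrec rho (r 0%N i t) (fun j => rho * (U j t + V j t) + e j i t) n.
  apply: (le_linrec (z := fun j => r j i t)) => // j.
  rewrite (le_trans (rS j i t))// addrA lerD2r -mulrDr.
  rewrite (le_trans (sqrt_mean_field_le _ _ _ _))//.
    by rewrite mulr_ge0 ?invr_ge0// sumr_ge0.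
  rewrite ler_wpM2l// lerD2l.
  apply: (@mean_le_linrec _ _ q beta (fun a l => r a l t) (fun a l => e a l t) j) => //.
have := moment_le_linrec n p1 rho0 rho1 (rA i) wA.
move=> /(moment_le_le p0)/(_ (mr n i) (r0 n i) rle) [mrn r0n rnA].
split => //; apply: le_trans rnA _; rewrite lee_fin -/k.
have AwE : Aw A0 = Aw 0 + c1 * A0 by rewrite /c1 /Aw /AV /AU; ring.
have : k * Aw A0 <= k * `|Aw 0| + k * `|c1| * A0.
  rewrite AwE mulrDr -mulrA lerD// ler_wpM2l ?ler_norm//.
  by rewrite ler_wpM2r// ler_norm.
have : 0 <= k * `|Aw 0| * A0 by rewrite mulr_ge0// mulr_ge0.
have : 0 <= k * `|c1| by rewrite mulr_ge0.
lra.
Qed.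

(** * Brownian increments and product spaces *)

Lemma moment_le_brownian_increment d (T : measurableType d) (R : realType)
  (P : probability T R) (k : nat) (F : R -> set_system T)
  (B : R -> T -> 'cV[R]_k) (p s t : R) : 1 <= p ->
  complete_usual_filtration P F -> brownian_motion P F B -> 0 <= s -> s < t ->
  moment_le P p (fun w => hsnorm (B t w - B s w))
    (k%:R `^ p * fine (\int[normal_prob 0 (Num.sqrt (t - s))]_x (`|x| `^ p)%:E)%E).
Proof.
move=> p1 [_ Fsub _ _ _] [_ _ Bad _ Blaw] s0 st.
have p0 : 0 < p by rewrite (lt_le_trans ltr01).
have mB u i : 0 <= u -> measurable_fun setT (fun w => B u w i ord0).
  move=> u0; apply: (measurableT_comp (measurable_coord _ _)) => _ A mA.
  by apply: (Fsub u u0).2; apply: (Bad u u0); exists A.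
set M := (\int[normal_prob 0 (Num.sqrt (t - s))]_x (`|x| `^ p)%:E)%E.
have M_fin : M \is a fin_num.
  rewrite ge0_fin_numE; last by apply: integral_ge0 => x _; rewrite lee_fin powR_ge0.
  by apply: normal_prob_moment_lty; rewrite // sqrtr_gt0 subr_gt0.
have mD i : measurable_fun setT (fun w => (B t w - B s w) i ord0).
  under eq_fun do rewrite !mxE.
  by apply: measurable_funB; apply: mB => //; exact: le_trans (ltW st).
have DA i : moment_le P p (fun w => `|(B t w - B s w) i ord0|) (fine M).
  split => //; first exact: measurableT_comp (mD i).
  rewrite fineK// /M.
  pose D : T -> measurableTypeR R := fun w => (B t w - B s w) i ord0.
  have mDR : measurable_fun setT D := mD i.
  pose f (x : measurableTypeR R) : \bar R := (`|x| `^ p)%:E.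
  have mf : measurable_fun setT f.
    by apply: measurable_powR_EFin; exact: normr_measurable.
  have f0 : {in setT, forall x, 0 <= f x}%E.
    by move=> x _; rewrite lee_fin powR_ge0.
  have := ge0_integral_pushforward mDR P measurableT mf f0.
  rewrite preimage_setT => <-; rewrite le_eqVlt; apply/orP; left; apply/eqP.
  apply: eq_measure_integral => A mA _; rewrite /= /pushforward.
  (* A rectangle with [A] in coordinate [i] and the whole line elsewhere yields the marginal law of
     that coordinate. *)
  have := Blaw s t s0 st (fun j => if j == i then A else setT).
  rewrite (bigD1 i)//= eqxx big1 ?mule1 => [<-|j /negPf ->].
  - congr (P _); apply/seteqP; split => [w Aw j|w /(_ i)]; last by rewrite eqxx.
    by case: eqP => // ->.
  - by move=> j; case: ifP.
  - exact: probability_setT.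
apply: (moment_le_le (ltW p0) (moment_le_sum p1 DA)).
- exact: measurable_fun_hsnorm.
- by move=> w; exact: hsnorm_ge0.
- by move=> w; exact: hsnorm_le_sum.
Qed.

Lemma ge0_integral_fst d1 d2 (T1 : measurableType d1) (T2 : measurableType d2)
  (R : realType) (P1 : probability T1 R) (P2 : probability T2 R)
  (f : T1 -> \bar R) : measurable_fun setT f -> (forall x, 0 <= f x)%E ->
  (\int[P1 \x P2]_w f w.1 = \int[P1]_x f x)%E.
Proof.
move=> mf f0; rewrite fubini_tonelli1//=.
  apply: eq_integral => x _; rewrite /fubini_F/= integral_cst//.
  by rewrite [X in (_ * X)%E]probability_setT mule1.
exact: measurableT_comp mf measurable_fst.
Qed.

Lemma ge0_integral_snd d1 d2 (T1 : measurableType d1) (T2 : measurableType d2)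
  (R : realType) (P1 : probability T1 R) (P2 : probability T2 R)
  (f : T2 -> \bar R) : measurable_fun setT f -> (forall x, 0 <= f x)%E ->
  (\int[P1 \x P2]_w f w.2 = \int[P2]_x f x)%E.
Proof.
move=> mf f0; rewrite fubini_tonelli2//=.
  apply: eq_integral => x _; rewrite /fubini_G/= integral_cst//.
  by rewrite [X in (_ * X)%E]probability_setT mule1.
exact: measurableT_comp mf measurable_snd.
Qed.

Lemma moment_le_fst d1 d2 (T1 : measurableType d1) (T2 : measurableType d2)
  (R : realType) (P1 : probability T1 R) (P2 : probability T2 R) (p A : R)
  (f : T1 -> R) : moment_le P1 p f A ->
  moment_le (P1 \x P2)%E p (fun w => f w.1) A.
Proof.
move=> [mf f0 fA]; split => //; first exact: measurableT_comp mf measurable_fst.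
rewrite (ge0_integral_fst P1 P2 (measurable_powR_EFin p mf))// => x.
by rewrite lee_fin powR_ge0.
Qed.

Lemma moment_le_snd d1 d2 (T1 : measurableType d1) (T2 : measurableType d2)
  (R : realType) (P1 : probability T1 R) (P2 : probability T2 R) (p A : R)
  (f : T2 -> R) : moment_le P2 p f A ->
  moment_le (P1 \x P2)%E p (fun w => f w.2) A.
Proof.
move=> [mf f0 fA]; split => //; first exact: measurableT_comp mf measurable_snd.
rewrite (ge0_integral_snd P1 P2 (measurable_powR_EFin p mf))// => x.
by rewrite lee_fin powR_ge0.
Qed.

(** * One step of the scheme *)

Lemma sqrtrD_le (R : rcfType) (a b : R) : 0 <= a -> 0 <= b ->
  Num.sqrt (a + b) <= Num.sqrt a + Num.sqrt b.
Proof.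
move=> a0 b0.
rewrite -ler_sqr ?nnegrE ?addr_ge0 ?sqrtr_ge0// sqrrD !sqr_sqrtr ?addr_ge0//.
by rewrite lerD2r lerDl mulrn_wge0// mulr_ge0 ?sqrtr_ge0.
Qed.

(** The additive constant is split off by subadditivity of the square root, so that it can be
    counted as noise. *)
Lemma tamed_drift_le (R : realType) (d N : nat) (N0 : (0 < N)%N)
  (b : 'cV[R]_d -> probability 'cV[R]_d R -> 'cV[R]_d)
  (lam2 l K lb1 lb2 lb3 alpha h Khat : R) (x : 'I_N -> 'cV[R]_d) (i : 'I_N) :
  0 < lam2 -> 0 <= l -> 0 < K -> 0 < lb2 -> 0 < lb3 -> 2 * lb2 < lb1 ->
  0 < alpha -> alpha <= 1 -> 0 < h -> Num.sqrt h <= 1 -> h * lb1 <= 1 ->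
  Khat = 2 * K + lam2 + hsnorm (b 0 delta0) ->
  3 * Khat ^+ 2 * Num.sqrt h * (1 + 2 * alpha) <= 2 * alpha * (lb1 - 2 * lb2) ->
  (forall (x : 'cV[R]_d) (mu nu : probability 'cV[R]_d R),
    finite_first_moment mu -> finite_first_moment nu ->
    ((hsnorm (b x mu - b x nu))%:E <= lam2%:E * W1 mu nu)%E) ->
  (forall (x y : 'cV[R]_d) (mu : probability 'cV[R]_d R),
    finite_first_moment mu ->
    hsnorm (b x mu - b y mu) <=
      K * (1 + hsnorm x `^ l + hsnorm y `^ l) * hsnorm (x - y)) ->
  (forall (x : 'cV[R]_d) (mu : probability 'cV[R]_d R),
    finite_first_moment mu ->
    ((dotv x (b x mu))%:E <=
      (- lb1 * hsnorm x `^ (l + 2))%:E + lb2%:E * W1 mu delta0 ^+ 2 + lb3%:E)%E) ->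
  hsnorm (x i + (h / (1 + alpha * Num.sqrt h * hsnorm (x i) `^ l))
                  *: b (x i) (empirical N0 x)) <=
  Num.sqrt ((1 - h * (lb1 - 3 / 4 * (lb1 - 2 * lb2))) * hsnorm (x i) ^+ 2
    + (2 * h * lb2 + h ^+ 2 * Khat * lam2) *
      (N%:R^-1 * \sum_j hsnorm (x j)) ^+ 2)
  + Num.sqrt (1 + 2 * h * lb3 + h ^+ 2 * Khat * (9 / 2 * K + hsnorm (b 0 delta0))).
Proof.
move=> lam20 l0 K0 lb20 lb30 lb12 al0 al1 h0 s1 hlb1 KhatE hs b_W1 b_poly b_coer.
set mu := empirical N0 x : probability _ _.
set m := N%:R^-1 * \sum_j hsnorm (x j).
have m0 : 0 <= m by rewrite mulr_ge0 ?invr_ge0// sumr_ge0// => j _; exact: hsnorm_ge0.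
have b00 := hsnorm_ge0 (b 0 delta0).
have s0 : 0 < Num.sqrt h by rewrite sqrtr_gt0.
have hE : h = Num.sqrt h ^+ 2 by rewrite sqr_sqrtr// ltW.
have mu1 : finite_first_moment mu by exact: finite_first_moment_empirical.
have [w [w0 wm wE]] : exists w : R, [/\ 0 <= w, w <= m & W1 mu delta0 = w%:E].
  have Wm : (W1 mu delta0 <= m%:E)%E.
    apply: le_trans (W1_delta0_le mu) _.
    rewrite ge0_integral_empirical; last 2 first.
    - by apply/measurable_EFinP; exact: measurable_hsnorm.
    - by move=> y; rewrite lee_fin hsnorm_ge0.
    by rewrite sumEFin -EFinM.
  have W0 := W1_ge0 mu delta0.
  have Wfin : W1 mu delta0 \is a fin_num by rewrite ge0_fin_numE// (le_lt_trans Wm)// ltry.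
  exists (fine (W1 mu delta0)); rewrite fineK//; split => //.
    exact: fine_ge0.
  by rewrite -lee_fin fineK.
(* At [y = 0] the growth factor is [1 + T + 0 ^ l], where [0 ^ l] is 1 if [l = 0] and 0 otherwise;
   hence [2 + T]. *)
have pow0 : 0 `^ l <= 1 :> R.
  by have [->|l_neq0] := eqVneq l 0; rewrite ?powRr0// powR0.
have pow1 : 1 `^ l = 1 :> R by rewrite powR1.
set X := hsnorm (x i); set T := X `^ l.
have X0 : 0 <= X by exact: hsnorm_ge0.
have T0 : 0 <= T by exact: powR_ge0.
have BP : hsnorm (b (x i) mu) <= K * (2 + T) * X + lam2 * m + hsnorm (b 0 delta0).
  rewrite (_ : b (x i) mu = (b (x i) mu - b 0 mu) + (b 0 mu - b 0 delta0) + b 0 delta0);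
    last by rewrite addrA subrK subrK.
  rewrite (le_trans (ler_hsnormD _ _))// lerD2r (le_trans (ler_hsnormD _ _))// lerD//.
    apply: le_trans (b_poly _ _ _ mu1) _; rewrite subr0 hsnorm0 -/X -/T.
    by rewrite ler_wpM2r// ler_wpM2l ?(ltW K0)//; lra.
  have := b_W1 0 mu delta0 mu1 (finite_first_moment_delta0 R d).
  by rewrite wE -EFinM lee_fin => /le_trans; apply; rewrite ler_wpM2l// ltW.
have innerP : dotv (x i) (b (x i) mu) <= - lb1 * (T * X ^+ 2) + lb2 * m ^+ 2 + lb3.
  have := b_coer (x i) mu mu1; rewrite wE -/X.
  have -> : X `^ (l + 2) = T * X ^+ 2.
    by rewrite powRD ?powR_mulrn//; apply/implyP; rewrite gt_eqF// ltr_wpDl.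
  rewrite -EFin_expe -EFinM -!EFinD lee_fin => /le_trans; apply.
  by rewrite lerD2r lerD2l ler_wpM2l ?(ltW lb20)// ler_sqr ?nnegrE.
have XT : 1 <= X -> 1 <= T.
  by move=> X1; rewrite -pow1 ge0_ler_powR ?nnegrE.
have XT' : X < 1 -> T <= 1.
  by move=> X1; rewrite -pow1 ge0_ler_powR ?nnegrE// ltW.
set eta := h / _.
have driftP := tamed_drift_ineq hE erefl KhatE K0 lam20 b00 lb20 lb30 lb12 al0 al1
  s0 s1 hlb1 hs T0 X0 m0 XT XT' innerP (hsnorm_ge0 _) BP.
have etaE : 0 <= eta.
  by rewrite divr_ge0 ?(ltW h0)// addr_ge0// !mulr_ge0// ltW.
have [q0 beta0 _] := tamed_contraction_factor hE KhatE K0 lam20 b00 lb20 lb12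
  al0 al1 s0 s1 hlb1 hs.
have Khat0 : 0 <= Khat by rewrite KhatE; lra.
rewrite -(ger0_norm (hsnorm_ge0 (x i + _))) -sqrtr_sqr sqr_hsnormD dotvZr hsnormZ.
rewrite ger0_norm// exprMn.
rewrite (le_trans _ (sqrtrD_le _ _))//; first last.
- by nonneg; lra.
- by nonneg.
rewrite ler_wsqrtr//; exact: driftP.
Qed.

Definition increment_moment (R : realType) (p h : R) (k : nat) : R :=
  k%:R `^ p * fine (\int[normal_prob 0 (Num.sqrt h)]_x (`|x| `^ p)%:E)%E.

Lemma moment_le_increment d (T : measurableType d) (R : realType)
  (P : probability T R) (k : nat) (F : R -> set_system T)
  (B : R -> T -> 'cV[R]_k) (p h : R) (n : nat) : 1 <= p -> 0 < h ->
  complete_usual_filtration P F -> brownian_motion P F B ->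
  moment_le P p (fun w => hsnorm (increment h B n w)) (increment_moment p h k).
Proof.
move=> p1 h0 PF BM.
have nh0 : 0 <= n%:R * h by rewrite mulr_ge0// ltW.
have nh : n%:R * h < n.+1%:R * h by rewrite ltr_pM2r// ltr_nat.
have := moment_le_brownian_increment p1 PF BM nh0 nh.
rewrite (_ : n.+1%:R * h - n%:R * h = h) //.
by rewrite -mulrBl -natrB// subSnn mul1r.
Qed.

Lemma tamed_noise_le (R : realType) (d m1 m2 : nat) (sig0 sig1 L : R)
  (S : 'M[R]_(d, m1)) (S' : 'M[R]_(d, m2)) (y dB dW : 'cV[R]_d)
  (dBbar : 'cV[R]_m1) (dWbar : 'cV[R]_m2) :
  Num.max (hsnorm S) (hsnorm S') <= L ->
  hsnorm (y + sig0 *: dB + S *m dBbar + sig1 *: dW + S' *m dWbar) <=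
  hsnorm y + (`|sig0| * hsnorm dB + L * hsnorm dBbar
    + (`|sig1| * hsnorm dW + L * hsnorm dWbar)).
Proof.
rewrite ge_max => /andP[SL S'L].
have SB : hsnorm (S *m dBbar) <= L * hsnorm dBbar.
  by rewrite (le_trans (ler_hsnormM _ _))// ler_wpM2r// hsnorm_ge0.
have S'W : hsnorm (S' *m dWbar) <= L * hsnorm dWbar.
  by rewrite (le_trans (ler_hsnormM _ _))// ler_wpM2r// hsnorm_ge0.
have := ler_hsnormD (y + sig0 *: dB + S *m dBbar + sig1 *: dW) (S' *m dWbar).
have := ler_hsnormD (y + sig0 *: dB + S *m dBbar) (sig1 *: dW).
have := ler_hsnormD (y + sig0 *: dB) (S *m dBbar).
have := ler_hsnormD y (sig0 *: dB).
rewrite !hsnormZ; lra.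
Qed.

Unset Implicit Arguments.

Theorem lemma3p2 (R : realType) (d m1 m2 : nat)
  (b : 'cV[R]_d -> probability 'cV[R]_d R -> 'cV[R]_d)
  (sig : 'cV[R]_d -> probability 'cV[R]_d R -> 'M[R]_(d, m1))
  (sigbar : 'cV[R]_d -> probability 'cV[R]_d R -> 'M[R]_(d, m2))
  (sig0 sig1 : R)
  (* (i) *)
  (b_loclip : forall z : 'cV[R]_d, exists r L : R, 0 < r /\
    forall x y : 'cV[R]_d, hsnorm (x - z) < r -> hsnorm (y - z) < r ->
      hsnorm (b x delta0 - b y delta0) <= L * hsnorm (x - y))
  (lam1 l0 : R) (phi : R -> R) (lam1_gt0 : 0 < lam1) (l0_ge1 : 1 <= l0)
  (phi_ge0 : forall r : R, 0 <= r -> 0 <= phi r)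
  (phi_incr : forall r s : R, 0 <= r -> r <= s -> phi r <= phi s)
  (phi_cont : {within `[0, +oo[, continuous phi}) (phi0 : phi 0 = 0)
  (b_diss : forall (x y : 'cV[R]_d) (mu : probability 'cV[R]_d R),
    finite_first_moment mu ->
    dotv (x - y) (b x mu - b y mu) <=
      hsnorm (x - y) * phi (hsnorm (x - y)) * (hsnorm (x - y) <= l0)%R%:R
      - lam1 * hsnorm (x - y) ^+ 2 * (l0 < hsnorm (x - y))%R%:R)
  (lam2 : R) (lam2_gt0 : 0 < lam2)
  (b_W1 : forall (x : 'cV[R]_d) (mu nu : probability 'cV[R]_d R),
    finite_first_moment mu -> finite_first_moment nu ->
    ((hsnorm (b x mu - b x nu))%:E <= lam2%:E * W1 mu nu)%E)
  (* (ii) *)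
  (l K : R) (l_ge0 : 0 <= l) (K_gt0 : 0 < K)
  (b_poly : forall (x y : 'cV[R]_d) (mu : probability 'cV[R]_d R),
    finite_first_moment mu ->
    hsnorm (b x mu - b y mu) <=
      K * (1 + hsnorm x `^ l + hsnorm y `^ l) * hsnorm (x - y))
  (* (iii) *)
  (Lhat : R) (Lhat_gt0 : 0 < Lhat)
  (sig_bdd : forall (x : 'cV[R]_d) (mu : probability 'cV[R]_d R),
    finite_first_moment mu ->
    Num.max (hsnorm (sig x mu)) (hsnorm (sigbar x mu)) <= Lhat)
  (* (iv) *)
  (lb1 lb2 lb3 : R) (lb1_gt0 : 0 < lb1) (lb2_gt0 : 0 < lb2) (lb3_gt0 : 0 < lb3)
  (lb12 : 2 * lb2 < lb1)
  (b_coer : forall (x : 'cV[R]_d) (mu : probability 'cV[R]_d R),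
    finite_first_moment mu ->
    ((dotv x (b x mu))%:E <=
      (- lb1 * hsnorm x `^ (l + 2))%:E + lb2%:E * W1 mu delta0 ^+ 2 + lb3%:E)%E)
  (alpha : R) (alpha_gt0 : 0 < alpha) (alpha_le1 : alpha <= 1) :
  let Khat := 2 * K + lam2 + hsnorm (b 0 delta0) in
  let hstar := Num.min 1 (Num.min (1 / lb1)
    (4 * alpha ^+ 2 * (lb1 - 2 * lb2) ^+ 2 /
      (9 * Khat ^+ 4 * (1 + 2 * alpha) ^+ 2))) in
  forall p h : R, 1 <= p -> 0 < h -> h <= hstar ->
  exists2 C : R, 0 < C &
  forall (N : nat) (N0 : (0 < N)%N)
    (dB dW : measure_display)
    (OmB : measurableType dB) (OmW : measurableType dW)
    (PB : probability OmB R) (PW : probability OmW R)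
    (FB : R -> set_system OmB) (FW : R -> set_system OmW)
    (B : 'I_N -> R -> OmB -> 'cV[R]_d) (Bbar : 'I_N -> R -> OmB -> 'cV[R]_m1)
    (W : R -> OmW -> 'cV[R]_d) (Wbar : R -> OmW -> 'cV[R]_m2)
    (X0 : 'I_N -> {RV PB >-> 'cV[R]_d})
    (X : nat -> 'I_N -> {RV (PB \x PW)%E >-> 'cV[R]_d}),
    complete_usual_filtration PB FB ->
    complete_usual_filtration PW FW ->
    (forall i, brownian_motion PB FB (B i)) ->
    (forall i, brownian_motion PB FB (Bbar i)) ->
    brownian_motion PW FW W ->
    brownian_motion PW FW Wbar ->
    mutually_independent PB (fun k : 'I_N + 'I_N =>
      match k with
      | inl i => process_sigma (B i)
      | inr i => process_sigma (Bbar i)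
      end) ->
    mutually_independent PW (fun k : bool =>
      if k then process_sigma W else process_sigma Wbar) ->
    iid X0 ->
    (forall i, preimage_set_system setT (X0 i) measurable `<=` FB 0) ->
    tamed_euler_scheme b sig sigbar sig0 sig1 alpha l h N0 B Bbar W Wbar X0 X ->
    forall (n : nat) (i : 'I_N),
      ('E_(PB \x PW)[fun w => (hsnorm (X 0%N i w) `^ p)%R] < +oo)%E ->
      ('E_(PB \x PW)[fun w => (hsnorm (X n i w) `^ p)%R] <=
        C%:E * (1 + 'E_(PB \x PW)[fun w => (hsnorm (X 0%N i w) `^ p)%R]))%E.

Proof.
move=> Khat hstar p h p1 h0 hh.
have D0 : 0 < lb1 - 2 * lb2 by rewrite subr_gt0.
have b00 := hsnorm_ge0 (b 0 delta0).
have Khat0 : 0 < Khat by rewrite /Khat; lra.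
have [s1 hlb1 hs] := step_size_bound Khat0 lb1_gt0 D0 alpha_gt0 h0 hh.
have s0 : 0 < Num.sqrt h by rewrite sqrtr_gt0.
have hE : h = Num.sqrt h ^+ 2 by rewrite sqr_sqrtr// ltW.
have [q0 beta0 qb1] := tamed_contraction_factor hE (erefl Khat) K_gt0 lam2_gt0
  b00 lb2_gt0 lb12 alpha_gt0 alpha_le1 s0 s1 hlb1 hs.
set c := Num.sqrt (1 + 2 * h * lb3 + h ^+ 2 * Khat * (9 / 2 * K + hsnorm (b 0 delta0))).
pose M := increment_moment p h.
(* The nested factors follow the bracketing of the sum [e] below: one application of [moment_leD]
   for each factor. *)
pose Ae := 2 `^ p * (c `^ p +
  2 `^ p * (2 `^ p * (`|sig0| `^ p * M d + Lhat `^ p * M m1) +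
            2 `^ p * (`|sig1| `^ p * M d + Lhat `^ p * M m2))).
have [C C0 CP] := mean_field_moment Ae p1 q0 beta0 qb1.
exists C => // N N0 dB dW OmB OmW PB PW FB FW B Bbar W Wbar X0 X PFB PFW BB BBbar
  BW BWbar _ _ [_ X0d] _ [X0E XS] n i EX0.
pose PP : probability (OmB * OmW)%type R := (PB \x PW)%E.
pose r n i w := hsnorm (X n i w).
pose e (n : nat) (i : 'I_N) (w : OmB * OmW) :=
  c + (`|sig0| * hsnorm (increment h (B i) n w.1)
       + Lhat * hsnorm (increment h (Bbar i) n w.1)
       + (`|sig1| * hsnorm (increment h W n w.2)
          + Lhat * hsnorm (increment h Wbar n w.2))).
have mr k j : measurable_fun setT (r k j).
  apply: measurable_fun_hsnorm => a.
  apply: (measurableT_comp (measurable_coord a ord0)).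
  exact: measurable_funPT.
have eA k j : moment_le PP p (e k j) Ae.
  apply: moment_leD => //; first by apply: moment_le_cst; exact: sqrtr_ge0.
  apply: moment_leD => //; apply: moment_leD => //; apply: moment_leZ => //;
    try exact: ltW.
  - exact: moment_le_fst (moment_le_increment _ p1 h0 PFB (BB j)).
  - exact: moment_le_fst (moment_le_increment _ p1 h0 PFB (BBbar j)).
  - exact: moment_le_snd (moment_le_increment _ p1 h0 PFW BW).
  - exact: moment_le_snd (moment_le_increment _ p1 h0 PFW BWbar).
have Er k : ('E_PP[fun w => (hsnorm (X k i w) `^ p)%R] =
    \int[PP]_w (r k i w `^ p)%:E)%E by rewrite unlock.
rewrite Er in EX0; rewrite !Er.
pose A0 := fine (\int[PP]_w (r 0%N i w `^ p)%:E)%E.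
have A0E : A0%:E = (\int[PP]_w (r 0%N i w `^ p)%:E)%E.
  rewrite fineK// ge0_fin_numE//; apply: integral_ge0 => w _.
  by rewrite lee_fin powR_ge0.
(* The initial moments depend only on the laws of the [X0 j], which coincide; finiteness for
   particle [i] thus gives the bound [A0] for all particles, as the mean field requires. *)
have rE j : (\int[PP]_w (r 0%N j w `^ p)%:E =
    \int[distribution PB (X0 j)]_y (hsnorm y `^ p)%:E)%E.
  have mh : measurable_fun setT (fun y : 'cV[R]_d => (hsnorm y `^ p)%:E).
    by apply: measurable_powR_EFin; exact: measurable_hsnorm.
  rewrite (ge0_integral_distribution (X0 j) mh); last first.
    by move=> y; rewrite lee_fin powR_ge0.
  rewrite -(ge0_integral_fst PB PW (measurableT_comp mh (measurable_funPT (X0 j)))).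
    by apply: eq_integral => w _; rewrite /r X0E.
  by move=> y; rewrite lee_fin powR_ge0.
have rA j : moment_le PP p (r 0%N j) A0.
  split => //; first by move=> w; exact: hsnorm_ge0.
  rewrite A0E !rE le_eqVlt; apply/orP; left; apply/eqP.
  by apply: eq_measure_integral => A mA _; exact: X0d.
rewrite -A0E -EFinD -EFinM.
have rS k j w : r k.+1 j w <= Num.sqrt
    ((1 - h * (lb1 - 3 / 4 * (lb1 - 2 * lb2))) * r k j w ^+ 2
    + (2 * h * lb2 + h ^+ 2 * Khat * lam2) * (N%:R^-1 * \sum_a r k a w) ^+ 2)
    + e k j w.
  rewrite /r XS /tamed_euler_step.
  rewrite (le_trans (tamed_noise_le _ _ _ _ _ _ _ (sig_bdd _ _ _)))//.
    exact: finite_first_moment_empirical.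
  rewrite /e [leRHS]addrA lerD2r.
  exact: (tamed_drift_le N0 (fun a => X k a w) j lam2_gt0 l_ge0 K_gt0 lb2_gt0 lb3_gt0
    lb12 alpha_gt0 alpha_le1 h0 s1 hlb1 (erefl Khat) hs b_W1 b_poly b_coer).
by have [_ _] := CP _ _ PP N r e A0 N0 mr (fun k j w => hsnorm_ge0 _) eA rA rS n i.
Qed.
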